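(* For each $n\ge1$ let $p_{n,1},\dots,p_{n,n}\in[0,1]$, let $\mu_{n,i}=p_{n,i}\delta_1+(1-p_{n,i})\delta_0$, and let $$\mu_n=\mu_{n,1}\boxplus\cdots\boxplus\mu_{n,n}.$$ Assume that $\sum_{i=1}^n p_{n,i}\to\lambda>1$ and $\max_i p_{n,i}\to0$ as $n\to\infty$. Let $x_{\min}=(1-\sqrt{\lambda})^2$, $x_{\max}=(1+\sqrt{\lambda})^2$, let $\varepsilon>0$ and $I_\varepsilon=[x_{\min}+\varepsilon,x_{\max}-\varepsilon]$. Then for all sufficiently large $n$, $\mu_n$ is (Lebesgue) absolutely continuous everywhere on $I_\varepsilon$, and the density $d\mu_n/dx$ converges uniformly on $I_\varepsilon$, as $n\to\infty$, to the density of the Marchenko--Pastur law with parameter $\lambda$.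
   Context: The Marchenko--Pastur distribution (free Poisson distribution) with parameter $\lambda\ge1$ is the probability measure on $\mathbb{R}$ with density $f_{\mathrm{mp}}(x)=\frac{\sqrt{4x-(1-\lambda+x)^2}}{2\pi x}$ supported on $[(1-\sqrt{\lambda})^2,(1+\sqrt{\lambda})^2]$. Here $\boxplus$ is free additive convolution; $\mu_n$ is the spectral distribution of $X_{n,1}+\cdots+X_{n,n}$, where the $X_{n,i}$ are freely independent self-adjoint random variables with distributions $\mu_{n,i}$. Definition: with $m_\mu(z):=\int_{\mathbb{R}}\frac{\mu(dx)}{x-z}$ for $z\in\mathbb{C}^+:=\{\Im z>0\}$, $\mu_1\boxplus\mu_2$ is the probability measure whose Stieltjes transform satisfies $m_{\mu_1\boxplus\mu_2}(z)=m_{\mu_1}(\omega_1(z))=m_{\mu_2}(\omega_2(z))$ and $z-1/m_{\mu_1\boxplus\mu_2}(z)=\omega_1(z)+\omega_2(z)$ on $\mathbb{C}^+$, where $\omega_1,\omega_2:\mathbb{C}^+\to\mathbb{C}^+$ are analytic with $\Im\omega_j(z)\ge\Im z$ and $\omega_j(z)=z+o(z)$ as $z\to\infty$ in each sector $\Im z>\kappa|\Re z|$, $\kappa>0$. The density of a free convolution at a point is understood as $\pi^{-1}\lim_{\eta\downarrow0}\Im m(x+i\eta)$, with $m$ its Stieltjes transform. *)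

(* Defs.v *)
From HB Require Import structures.
From mathcomp Require Import all_boot all_order all_algebra.
From mathcomp Require Import complex.
From mathcomp Require Import all_classical all_reals all_analysis.

Set Implicit Arguments.
Unset Strict Implicit.
Unset Printing Implicit Defensive.

Import Order.TTheory GRing.Theory Num.Theory.
Import numFieldNormedType.Exports.

Local Open Scope classical_set_scope.
Local Open Scope ring_scope.
Local Open Scope complex_scope.

(* [lebesgue_measure] lives on [measurableTypeR R], the Borel space of the
   line.  Measures are functions on all subsets; only their values on measurable
   sets are meaningful, so equality of laws is tested on measurable sets. *)
Notation real_law R := (probability (measurableTypeR R) R).

Section Bernoulli.
Context {R : realType}.

Definition bool_to_real (b : bool) : measurableTypeR R := b%:R.

Lemma measurable_bool_to_real : measurable_fun [set: bool] bool_to_real.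
Proof. by []. Qed.

HB.instance Definition _ :=
  isMeasurableFun.Build _ _ _ _ bool_to_real measurable_bool_to_real.

(* The image of the library's Bernoulli law on [bool], as a law on the line;
   [bernoulli_lawE] gives its form p \delta_1 + (1 - p) \delta_0. *)
Definition bernoulli_law (p : R) : real_law R :=
  distribution (bernoulli_prob p) bool_to_real.

Lemma bernoulli_lawE (p : R) (A : set (measurableTypeR R)) : 0 <= p <= 1 ->
  (bernoulli_law p A =
   p%:E * @dirac _ (measurableTypeR R) (1 : R)%R R A
   + (1 - p)%:E * @dirac _ (measurableTypeR R) (0 : R)%R R A)%E.
Proof.
move=> p01.
by rewrite /bernoulli_law /= /distribution /pushforward bernoulli_probE.
Qed.

End Bernoulli.

Section FreeConvolution.
Context {R : realType}.
Implicit Types (mu nu rho : real_law R) (z : R[i]).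

(* m_mu(z) = \int (x - z)^-1 mu(dx), integrated componentwise. *)
Definition stieltjes mu z : R[i] :=
  (\int[mu]_x complex.Re ((x%:C - z)^-1))%R
  +i* (\int[mu]_x complex.Im ((x%:C - z)^-1))%R.

(* Complex differentiability: over [R[i]^o] the scalars, hence the increments
   of the difference quotient, are complex. *)
Definition analytic_upper (w : R[i] -> R[i]) : Prop :=
  forall z, 0 < complex.Im z -> derivable (w : R[i]^o -> R[i]^o) z 1.

(* w(z) = z + o(z) as z -> oo in every sector Im z > kappa |Re z|.  [Normc.normc]
   is the modulus with values in [R] (the norm [`|z|] takes values in [R[i]]). *)
Definition asymp_id (w : R[i] -> R[i]) : Prop :=
  forall kappa : R, 0 < kappa -> forall e : R, 0 < e ->
  exists M : R, forall z,
    kappa * `|complex.Re z| < complex.Im z -> M < Normc.normc z ->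
    Normc.normc (w z - z) <= e * Normc.normc z.

Definition subordination (w : R[i] -> R[i]) : Prop :=
  [/\ analytic_upper w,
      forall z, 0 < complex.Im z -> complex.Im z <= complex.Im (w z)
    & asymp_id w].

(* [mu] is the free additive convolution of [mu1] and [mu2]. *)
Definition is_free_conv mu1 mu2 mu : Prop :=
  exists w1 w2 : R[i] -> R[i],
  [/\ subordination w1, subordination w2
    & forall z, 0 < complex.Im z ->
      [/\ stieltjes mu z = stieltjes mu1 (w1 z),
          stieltjes mu z = stieltjes mu2 (w2 z)
        & z - (stieltjes mu z)^-1 = w1 z + w2 z]].

(* [is_free_sum [:: nu_1; ...; nu_n] mu] : [mu] is the law
   (... (nu_1 [+] nu_2) [+] ...) [+] nu_n, with [+] the free additive
   convolution and n >= 1. *)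
Inductive is_free_sum : seq (real_law R) -> real_law R -> Prop :=
| is_free_sum1 mu nu :
    (forall A : set (measurableTypeR R), measurable A -> mu A = nu A) ->
    is_free_sum [:: nu] mu
| is_free_sum_rcons s nu rho mu :
    is_free_sum s rho -> is_free_conv rho nu mu -> is_free_sum (rcons s nu) mu.

End FreeConvolution.

Section Density.
Context {R : realType}.
Implicit Types (mu : real_law R) (lambda x : R).

(* pi^-1 lim_(eta -> 0+) Im m_mu(x + i eta); meaningful when the limit exists,
   which is part of [has_free_density_on]. *)
Definition free_density mu x : R :=
  pi^-1 * lim (complex.Im (stieltjes mu (x +i* eta)) @[eta --> 0^'+]).

(* On [D] the limit defining [free_density mu] exists everywhere, and
   [free_density mu] is a density of [mu] with respect to Lebesgue measure. *)
Definition has_free_density_on mu (D : set R) : Prop :=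
  (forall x, D x ->
     cvg (complex.Im (stieltjes mu (x +i* eta)) @[eta --> 0^'+])) /\
  (forall A : set (measurableTypeR R), measurable A -> A `<=` D ->
     mu A = \int[lebesgue_measure]_(x in A) (free_density mu x)%:E)%E.

Definition mp_min lambda : R := (1 - Num.sqrt lambda) ^+ 2.
Definition mp_max lambda : R := (1 + Num.sqrt lambda) ^+ 2.

Definition mp_density lambda x : R :=
  if mp_min lambda <= x <= mp_max lambda then
    Num.sqrt (4 * x - (1 - lambda + x) ^+ 2) / (2 * pi * x)
  else 0.

End Density.

(* Main.v *)
Require Import Defs.
From HB Require Import structures.
From mathcomp Require Import all_boot all_order all_algebra.
From mathcomp Require Import complex ring lra.
From mathcomp Require Import all_classical all_reals all_analysis.
From mathcomp Require Import measurable_realfun.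

(** Fix z with Im z > 0 and write m for the Stieltjes transform of mu_n at z,
    omega_i for the value at z of the i-th subordination function, F = -1/m,
    G = F - 1 and b_i = p_i (1 - p_i).  Composing the binary subordination
    relations gives sum_i omega_i = z + (n - 1) F, and m = m_(mu_i)(omega_i) is
    a quadratic equation for omega_i.  In the variables v_i = omega_i - 1 + p_i
    everything becomes ([bernoulli_sum_system])
      G = v_i - 2 p_i - b_i / v_i  and  z = 1 + G + sum_i (p_i + b_i / v_i).
    If every v_i is the large root of its equation, then v_i is close to G and
    z is close to 1 + lambda + G + lambda / G, which is the equation of the
    Marchenko-Pastur law.

    Both roots lie in the upper half-plane, so the danger is that some v_i is
    the small root.  This is excluded at each z separately, without following
    branches along a path: the imaginary part of the second equation says
    sum_i b_i / (b_i + |v_i|^2) < 1 ([sum_theta_lt1]).  A small root alone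
    contributes more than 1/2, so there is at most one, and then what it leaves
    for the others, about p_i / |G|^2, is less than what they contribute, about
    lambda / |G|^2 ([all_roots_large]).  The same inequality bounds |G| below.
    Hence z = 1 + lambda + G + lambda / G up to an error that tends to 0
    uniformly on the whole upper half-plane ([system_approx]).

    The map G + lambda / G sends the circle of radius sqrt lambda onto the
    interval [- 2 sqrt lambda, 2 sqrt lambda]; when Re z - 1 - lambda stays
    inside it, the argument of G stays away from 0 and pi ([bulk_slope]), where
    the map is bi-Lipschitz ([joukowski_stable]).  So G is Lipschitz in z up to
    the real axis ([system_lipschitz]) and close to its Marchenko-Pastur value.
    The first fact gives boundary values of Im m, and Stieltjes inversion turns
    them into a density of mu_n ([stieltjes_inversion]); the second gives the
    uniform convergence ([density_close]). *)

Set Implicit Arguments.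
Unset Strict Implicit.
Unset Printing Implicit Defensive.

Import Order.TTheory GRing.Theory Num.Theory.
Import numFieldNormedType.Exports.

Local Open Scope classical_set_scope.
Local Open Scope ring_scope.
Local Open Scope complex_scope.

(** * Modulus, real and imaginary parts *)

Local Notation Re := (@complex.Re _).
Local Notation Im := (@complex.Im _).
Local Notation modc := (@Normc.normc _).

Section ComplexModulus.
Context {R : realType}.
Implicit Types (z w : R[i]) (a : R).

Lemma modc_sqr z : modc z ^+ 2 = Re z ^+ 2 + Im z ^+ 2.
Proof. by case: z => a b /=; rewrite sqr_sqrtr// addr_ge0// sqr_ge0. Qed.

Lemma modc_ge0 z : 0 <= modc z.
Proof. by case: z => a b; exact: sqrtr_ge0. Qed.

Lemma modc_eq0 z : (modc z == 0) = (z == 0).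
Proof.
apply/eqP/eqP => [/Normc.eq0_normc //|->]; exact: Normc.normc0.
Qed.

Lemma modc_gt0 z : (0 < modc z) = (z != 0).
Proof. by rewrite lt0r modc_ge0 andbT modc_eq0. Qed.

Lemma modcR a : modc a%:C = `|a|.
Proof. by rewrite /= expr0n /= addr0 sqrtr_sqr. Qed.

Lemma modcN z : modc (- z) = modc z.
Proof. exact: normcN. Qed.

Lemma modcD z w : modc (z + w) <= modc z + modc w.
Proof. exact: le_normcD. Qed.

Lemma modcB z w : modc (z - w) <= modc z + modc w.
Proof. by rewrite -(modcN w) modcD. Qed.

Lemma modc_distC z w : modc (z - w) = modc (w - z).
Proof. by rewrite -modcN opprB. Qed.

Lemma modc_Im z : `|Im z| <= modc z.
Proof.
rewrite -(@ler_pXn2r _ 2)// ?nnegrE ?modc_ge0// modc_sqr.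
by rewrite real_normK ?num_real// lerDr sqr_ge0.
Qed.

Lemma modc_Re z : `|Re z| <= modc z.
Proof.
rewrite -(@ler_pXn2r _ 2)// ?nnegrE ?modc_ge0// modc_sqr.
by rewrite real_normK ?num_real// lerDl sqr_ge0.
Qed.

Lemma modc_sum n (f : 'I_n -> R[i]) :
  modc (\sum_(i < n) f i) <= \sum_(i < n) modc (f i).
Proof.
elim/big_ind2 : _ => [|x1 x2 y1 y2 h1 h2|//]; first by rewrite Normc.normc0.
by rewrite (le_trans (modcD _ _))// lerD.
Qed.

Lemma ImD z w : Im (z + w) = Im z + Im w.
Proof. by case: z w => [? ?] [? ?]. Qed.

Lemma ImN z : Im (- z) = - Im z.
Proof. by case: z. Qed.

Lemma ReD z w : Re (z + w) = Re z + Re w.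
Proof. by case: z w => [? ?] [? ?]. Qed.

Lemma ReN z : Re (- z) = - Re z.
Proof. by case: z. Qed.

Lemma Im_sum n (f : 'I_n -> R[i]) :
  Im (\sum_(i < n) f i) = \sum_(i < n) Im (f i).
Proof. by apply: (big_morph Im ImD). Qed.

Lemma Im_realdiv a z : Im (a%:C / z) = - (a / modc z ^+ 2 * Im z).
Proof.
rewrite modc_sqr; case: z => x y /=.
by rewrite mul0r addr0 mulrN mulrA mulrAC.
Qed.

Lemma Re_realdiv a z : Re (a%:C / z) = a / modc z ^+ 2 * Re z.
Proof.
rewrite modc_sqr; case: z => x y /=.
by rewrite mul0r subr0 mulrA mulrAC.
Qed.

Lemma Im_neq0 z : 0 < Im z -> z != 0.
Proof. by move=> h; apply/eqP => z0; rewrite z0 ltxx in h. Qed.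

End ComplexModulus.

(** * The equations satisfied by the subordination functions *)

Definition bern_var {R : realType} (p : R) : R := p * (1 - p).

(** Here [G] stands for -1/m - 1 and [v i] for omega_i - 1 + p_i: these shifts
    bring the negative inverse of the Bernoulli transform to the form
    [v - b / v], up to a constant. *)
Definition subordination_system {R : realType} (n : nat) (p : 'I_n -> R)
    (z G : R[i]) (v : 'I_n -> R[i]) : Prop :=
  [/\ 0 < Im z, forall i, 0 < Im (v i),
      forall i, G = v i - (p i *+ 2)%:C - (bern_var (p i))%:C / v i
    & z = 1 + G + \sum_(i < n) ((p i)%:C + (bern_var (p i))%:C / v i)].

(** The scale is [q ^+ 2] because the two roots of [v - b / v = g] are within
    [sqrt b <= q] of [g] and of 0; the value 1/30 leaves room for the numerical
    margins of the proofs below. *)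
Definition sparse {R : realType} (n : nat) (p : 'I_n -> R) (q : R) : Prop :=
  [/\ 0 <= q <= 30^-1, forall i, 0 <= p i <= q ^+ 2
    & 1 <= \sum_(i < n) p i].

Section OneRoot.
Context {R : realType}.
Implicit Types (p q b : R) (v G : R[i]).

Lemma sqr_small q : 0 <= q <= 30^-1 -> q ^+ 2 <= 900^-1.
Proof.
have -> : 900^-1 = (30^-1) ^+ 2 :> R by field.
by move=> /andP[q0 q1]; rewrite ler_pXn2r ?nnegrE// invr_ge0.
Qed.

Lemma bern_var_bound p q : 0 <= q <= 30^-1 -> 0 <= p <= q ^+ 2 ->
  [/\ 0 <= bern_var p <= p, p * (899 / 900) <= bern_var p,
      p <= 900^-1 & p *+ 2 <= q].
Proof.
move=> /andP[q0 q1] /andP[p0 p1].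
have q2 : q ^+ 2 <= 900^-1 by apply: sqr_small; apply/andP.
have qq : q ^+ 2 *+ 2 <= q by rewrite expr2; nra.
by rewrite /bern_var; split; first (apply/andP; split); nra.
Qed.

(** The two roots have product [- bern_var p], so the other one, whose opposite
    is the term [bern_var p / v], is at most [sqrt (bern_var p) <= q]. *)
Lemma large_root_dist p q v G : 0 <= q <= 30^-1 -> 0 <= p <= q ^+ 2 ->
    v != 0 -> G = v - (p *+ 2)%:C - (bern_var p)%:C / v ->
    bern_var p <= modc v ^+ 2 ->
  modc (v - G) <= q *+ 2.
Proof.
move=> q01 p01 v0 eG hv.
have [/andP[b0 bp] _ _ pq] := bern_var_bound q01 p01.
have vgt0 : 0 < modc v by rewrite modc_gt0.
have -> : v - G = (p *+ 2)%:C + (bern_var p)%:C / v by rewrite eG; ring.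
rewrite (le_trans (modcD _ _))// [leRHS]mulr2n lerD//.
  by rewrite modcR ger0_norm// mulrn_wge0//; case/andP: p01.
rewrite Normc.normcM Normc.normcV modcR ger0_norm//.
have /andP[q0 _] := q01.
rewrite -(@ler_pXn2r _ 2)// ?nnegrE ?divr_ge0 ?modc_ge0//.
rewrite expr_div_n ler_pdivrMr ?exprn_gt0//.
have bq : bern_var p <= q ^+ 2 by case/andP: p01 => _; exact: le_trans.
by rewrite expr2 ler_pM.
Qed.

Lemma large_root_modc p q v G : 0 <= q <= 30^-1 -> 0 <= p <= q ^+ 2 ->
    v != 0 -> G = v - (p *+ 2)%:C - (bern_var p)%:C / v ->
    bern_var p <= modc v ^+ 2 ->
  modc G - 15^-1 <= modc v <= modc G + 15^-1.
Proof.
move=> q01 p01 v0 eG hv.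
have := large_root_dist q01 p01 v0 eG hv.
have /andP[_ q1] := q01.
have := modcD (v - G) G; rewrite subrK.
have := modcD (G - v) v; rewrite subrK modc_distC.
by move=> h1 h2 h3; apply/andP; split; lra.
Qed.

(** Vieta: the product of the two roots is [- bern_var p]. *)
Lemma conjugate_root p v G : v != 0 -> 0 < bern_var p ->
    G = v - (p *+ 2)%:C - (bern_var p)%:C / v ->
  let w := - (bern_var p)%:C / v in
  [/\ w != 0, modc w = bern_var p / modc v &
      G = w - (p *+ 2)%:C - (bern_var p)%:C / w].
Proof.
move=> v0 b0 eG w.
have bC0 : (bern_var p)%:C != 0 by rewrite fmorph_eq0 gt_eqF.
split.
- by rewrite /w mulf_eq0 negb_or invr_eq0 oppr_eq0 bC0 v0.
- by rewrite /w Normc.normcM modcN Normc.normcV modcR gtr0_norm.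
- by rewrite {1}eG /w; field; rewrite v0 bC0.
Qed.

End OneRoot.

Section System.
Context {R : realType} (n : nat) (p : 'I_n -> R) (q : R).
Hypothesis sp : sparse p q.
Let b i := bern_var (p i).

Let q01 : 0 <= q <= 30^-1. Proof. by case: sp. Qed.
Let q2_le : q ^+ 2 <= 900^-1. Proof. exact: sqr_small. Qed.
Let p01 i : 0 <= p i <= q ^+ 2. Proof. by have [_ + _] := sp; apply. Qed.
Let b_ge0 i : 0 <= b i.
Proof. by have [/andP[]] := bern_var_bound q01 (p01 i). Qed.

Section OnePoint.
Variables (z G : R[i]) (v : 'I_n -> R[i]).
Hypothesis sys : subordination_system p z G v.

Let v0 i : v i != 0.
Proof. by apply: Im_neq0; have [_ + _ _] := sys; apply. Qed.

Let vgt0 i : 0 < modc (v i). Proof. by rewrite modc_gt0. Qed.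

Let system_rootE i : G = v i - (p i *+ 2)%:C - (bern_var (p i))%:C / v i.
Proof. by have [_ _ + _] := sys; apply. Qed.

(** [theta i] is the share of [Im G] that the [i]-th summand subtracts from
    [Im z]; it exceeds 1/2 exactly when [v i] is the small root. *)
Let theta i := b i / (b i + modc (v i) ^+ 2).

Let bv_gt0 i : 0 < b i + modc (v i) ^+ 2.
Proof. by rewrite ltr_wpDl// exprn_gt0. Qed.

Lemma system_Im_gt0 : 0 < Im G.
Proof.
case: sp => _ _ L1.
have n0 : (0 < n)%N.
  rewrite lt0n; apply/eqP => n0.
  have s0 : \sum_(i < n) p i = 0.
    by apply: big1 => i _; have := ltn_ord i; rewrite [X in (_ < X)%N]n0.
  by rewrite s0 ler10 in L1.
pose i := Ordinal n0.
case: sys => _ vi /(_ i) -> _.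
rewrite !ImD !ImN Im_realdiv /= oppr0 addr0 opprK -/(b i).
by rewrite ltr_wpDr ?vi// mulr_ge0 ?(ltW (vi i))// divr_ge0 ?sqr_ge0.
Qed.

(** Since [Im G = Im (v i) * (1 + b i / |v i|^2)], the imaginary part of the
    equation for [z] reads [Im z = Im G * (1 - \sum_i theta i)]. *)
Lemma sum_theta_lt1 : \sum_(i < n) theta i < 1.
Proof.
have Gp := system_Im_gt0.
case: sys => zp vi eG ez.
have key i : Im ((p i)%:C + (b i)%:C / v i) = - (theta i * Im G).
  have -> : Im G = Im (v i) * ((b i + modc (v i) ^+ 2) / modc (v i) ^+ 2).
    rewrite (eG i) !ImD !ImN Im_realdiv /= oppr0 addr0 opprK -/(b i).
    by field; rewrite gt_eqF.
  rewrite ImD /= add0r Im_realdiv /theta; congr (- _); field.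
  by rewrite !gt_eqF.
have : 0 < Im G * (1 - \sum_(i < n) theta i).
  move: zp; rewrite ez !ImD /= add0r Im_sum.
  rewrite (eq_bigr _ (fun i _ => key i)).
  by rewrite sumrN -mulr_suml; congr (_ < _); ring.
by rewrite pmulr_rgt0// subr_gt0.
Qed.

Let theta_ge0 i : 0 <= theta i.
Proof. by rewrite /theta divr_ge0// ltW. Qed.

Let theta_large i : b i <= modc (v i) ^+ 2 ->
  b i / (q ^+ 2 + (modc G + 15^-1) ^+ 2) <= theta i.
Proof.
move=> hv; rewrite /theta ler_wpM2l// lef_pV2 ?posrE//; last first.
  by rewrite ltr_wpDl ?sqr_ge0// exprn_gt0// ltr_wpDl ?modc_ge0// invr_gt0.
have /andP[_ h] := large_root_modc q01 (p01 i) (v0 i) (system_rootE i) hv.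
have [/andP[_ bp] _ _ _] := bern_var_bound q01 (p01 i).
apply: lerD; first by rewrite (le_trans bp)//; case/andP: (p01 i).
by rewrite ler_pXn2r// ?nnegrE ?modc_ge0// addr_ge0 ?modc_ge0 ?invr_ge0.
Qed.

Let window_gt0 : 0 < q ^+ 2 + (modc G + 15^-1) ^+ 2.
Proof.
by rewrite ltr_wpDl ?sqr_ge0// exprn_gt0// ltr_wpDl ?modc_ge0// invr_gt0.
Qed.

Let sum_b_ge (A : pred 'I_n) :
  (\sum_(i < n | A i) p i) * (899 / 900) <= \sum_(i < n | A i) b i.
Proof.
rewrite mulr_suml; apply: ler_sum => i _.
by have [] := bern_var_bound q01 (p01 i).
Qed.

(** If [v i] were the small root, then [theta i > 1/2], so every other root is
    large and [\sum_(j != i) theta j < 1 - theta i].  The left side is at least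
    about [1 / |G|^2].  The right side is [b i / (b i + |w|^2)] for the
    conjugate root [w], which is close to [G]: it is at most about [q^2 / |G|^2]. *)
Lemma all_roots_large i : b i <= modc (v i) ^+ 2.
Proof.
rewrite leNgt; apply/negP => wrong.
have tw : 1 / 2 < theta i.
  by rewrite /theta ltr_pdivlMr ?bv_gt0//; lra.
have := sum_theta_lt1; rewrite (bigD1 i)//= => hs.
have hsum : \sum_(j < n | j != i) theta j < 1 - theta i by lra.
have right j : j != i -> b j <= modc (v j) ^+ 2.
  move=> ji; rewrite leNgt; apply/negP => wj.
  have tj : 1 / 2 < theta j by rewrite /theta ltr_pdivlMr ?bv_gt0//; lra.
  move: hsum; rewrite (bigD1 j)//=.
  have : 0 <= \sum_(k < n | (k != i) && (k != j)) theta k.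
    by apply: sumr_ge0 => k _; exact: theta_ge0.
  lra.
set D := q ^+ 2 + (modc G + 15^-1) ^+ 2.
have Dgt0 : 0 < D by exact: window_gt0.
have B : 99 / 100 <= \sum_(j < n | j != i) b j.
  apply: le_trans (sum_b_ge _).
  case: sp => _ _; rewrite (bigD1 i)//=.
  have [_ _ + _] := bern_var_bound q01 (p01 i).
  lra.
have hD : (99 / 100) / D < 1 - theta i.
  apply: le_lt_trans hsum.
  apply: (@le_trans _ _ (\sum_(j < n | j != i) b j / D)).
    by rewrite -mulr_suml ler_wpM2r// invr_ge0 ltW.
  by apply: ler_sum => j /right; exact: theta_large.
have N0 := modc_ge0 G.
(* A first lower bound on |G|, so that |w| is comparable with |G| below. *)
have N1 : 13 / 10 <= modc G.
  have : (99 / 100) / D < 1 / 2 by lra.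
  rewrite ltr_pdivrMr// /D => h.
  rewrite leNgt; apply/negP => h2.
  have : (modc G + 15^-1) ^+ 2 <= (13 / 10 + 15^-1) ^+ 2.
    by rewrite ler_pXn2r// ?nnegrE; lra.
  by move: h q2_le; lra.
have bi0 : 0 < b i by rewrite (le_lt_trans _ wrong)// sqr_ge0.
have [] := conjugate_root (v0 i) bi0 (system_rootE i).
set w := - _ / _ => w0 mw eGw.
have ww : bern_var (p i) <= modc w ^+ 2.
  rewrite mw expr_div_n ler_pdivlMr ?exprn_gt0// expr2.
  by rewrite ler_wpM2l// ltW.
have /andP[hw _] := large_root_modc q01 (p01 i) w0 eGw ww.
have t1 : 1 - theta i = b i / (b i + modc w ^+ 2).
  rewrite mw /theta -/(b i); move: (b i) (modc (v i)) bi0 (vgt0 i) => c m c0 m0.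
  have h1 : 0 < c + m ^+ 2 by rewrite addr_gt0 ?exprn_gt0.
  by field; rewrite !gt_eqF// addr_gt0 ?mulr_gt0 ?exprn_gt0.
set x := (modc G - 15^-1) ^+ 2.
have x1 : 1 <= x by rewrite /x expr_ge1//; lra.
have xw : x <= modc w ^+ 2.
  by rewrite /x ler_pXn2r// ?nnegrE ?modc_ge0//; lra.
have t2 : 1 - theta i <= q ^+ 2 / x.
  rewrite t1 ler_pM ?invr_ge0 ?(ltW bi0)//.
  - by rewrite addr_ge0// ?sqr_ge0 ?(ltW bi0).
  - have [/andP[_ h1] _ _ _] := bern_var_bound q01 (p01 i).
    by rewrite (le_trans h1)//; case/andP: (p01 i).
  - rewrite lef_pV2 ?posrE; [|lra..]; lra.
have : (99 / 100) / D < q ^+ 2 / x by exact: lt_le_trans hD t2.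
rewrite ltr_pdivrMr// mulrAC ltr_pdivlMr; last lra.
have : (modc G + 15^-1) ^+ 2 <= x * 4.
  have -> : x * 4 = ((modc G - 15^-1) * 2) ^+ 2 by rewrite /x; ring.
  by rewrite ler_pXn2r// ?nnegrE; lra.
rewrite /D => h4 h5; have q2 := q2_le.
have : q ^+ 2 * (q ^+ 2 + (modc G + 15^-1) ^+ 2) <= 900^-1 * (900^-1 + x * 4).
  by rewrite ler_pM ?sqr_ge0 ?addr_ge0 ?sqr_ge0// lerD.
lra.
Qed.

(** With all roots large, [theta i] is at least about [b i / |G|^2]; the sum of
    the [b i] is almost at least 1 and the sum of the [theta i] is at most 1. *)
Lemma modc_G_ge : 4 / 5 <= modc G.
Proof.
set D := q ^+ 2 + (modc G + 15^-1) ^+ 2.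
have Dgt0 : 0 < D by exact: window_gt0.
have h : (899 / 900) / D < 1.
  apply: le_lt_trans sum_theta_lt1.
  apply: (@le_trans _ _ (\sum_(j < n) b j / D)).
    rewrite -mulr_suml ler_wpM2r ?invr_ge0 ?(ltW Dgt0)//.
    apply: le_trans (sum_b_ge _); case: sp => _ _; lra.
  by apply: ler_sum => j _; apply: theta_large; exact: all_roots_large.
move: h; rewrite ltr_pdivrMr// mul1r /D => h.
have N0 := modc_ge0 G.
rewrite leNgt; apply/negP => h2.
have : (modc G + 15^-1) ^+ 2 <= (4 / 5 + 15^-1) ^+ 2.
  by rewrite ler_pXn2r// ?nnegrE; lra.
by move: h q2_le; lra.
Qed.

Lemma modc_root_ge i : 1 / 2 <= modc (v i).
Proof.
have /andP[h _] :=
  large_root_modc q01 (p01 i) (v0 i) (system_rootE i) (all_roots_large i).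
have := modc_G_ge; lra.
Qed.

(** Better than the a priori bound [large_root_dist], of order [q], because
    [v i] is now known to be bounded away from 0. *)
Lemma root_dist i : modc (v i - G) <= 4 * p i.
Proof.
have eG := system_rootE i.
have [/andP[b0 bp] _ _ pq] := bern_var_bound q01 (p01 i).
have -> : v i - G = (p i *+ 2)%:C + (bern_var (p i))%:C / v i.
  by rewrite {1}eG; ring.
have p0 : 0 <= p i by case/andP: (p01 i).
rewrite (le_trans (modcD _ _))//.
rewrite Normc.normcM Normc.normcV !modcR !ger0_norm// ?mulrn_wge0//.
have : bern_var (p i) / modc (v i) <= p i * 2.
  rewrite ler_pdivrMr//; have := modc_root_ge i; nra.
rewrite -mulr_natr; lra.
Qed.

Lemma modc_root_le i : modc (v i) <= 2 * modc G.
Proof.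
have := root_dist i; have := modcD (v i - G) G; rewrite subrK.
have [_ _ + _] := bern_var_bound q01 (p01 i); have := modc_G_ge; lra.
Qed.

End OnePoint.
End System.

(** * Comparison with the Marchenko-Pastur equation *)

(** Measures the distance to the Marchenko-Pastur equation and to its difference
    quotients; the constants 3 and 300 dominate those of both estimates. *)
Definition sparse_error {R : realType} (n : nat) (p : 'I_n -> R)
    (q lambda : R) : R :=
  3 * `|\sum_(i < n) p i - lambda| + 300 * q ^+ 2 * \sum_(i < n) p i.

Lemma sparse_error_ge0 (R : realType) n (p : 'I_n -> R) (q lambda : R) :
  sparse p q -> 0 <= sparse_error p q lambda.
Proof.
case=> _ _ L1; have L0 := le_trans ler01 L1.
apply: addr_ge0; apply: mulr_ge0 => //.
by rewrite mulr_ge0 ?sqr_ge0.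
Qed.

Section Joukowski.
Context {R : realType}.

(** The real part of [G + s^2 / G] is [Re G * (1 + s^2 / r^2)] with [r = |G|],
    and [r^2 + s^2 >= 2 s r], so its being at most [2 s - e] in modulus forces
    [|Re G| <= (1 - e / (2 s)) r], whatever [r] is. *)
Lemma bulk_slope (s e : R) (z G : R[i]) : 0 < s -> 0 < Im G ->
  modc (z - 1 - (s ^+ 2)%:C - (G + (s ^+ 2)%:C / G)) <= e ->
  `|Re z - 1 - s ^+ 2| <= 2 * s - 2 * e ->
  e / (2 * s) * modc G ^+ 2 <= Im G ^+ 2.
Proof.
move=> s0 G0 h1 h2.
have Gn : 0 < modc G by rewrite modc_gt0 Im_neq0.
have e0 : 0 <= e by exact: le_trans (modc_ge0 _) h1.
set r := modc G in Gn *.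
have hr : `|Re G * (1 + s ^+ 2 / r ^+ 2)| <= 2 * s - e.
  have := le_trans (modc_Re _) h1.
  rewrite !ReD !ReN !ReD Re_realdiv -/r /=.
  move=> h3; move: h2 h3; rewrite !ler_norml.
  move=> /andP[a1 a2] /andP[b1 b2]; apply/andP; split; lra.
have hG : `|Re G| * (2 * s * r) <= (2 * s - e) * r ^+ 2.
  move: hr; rewrite normrM.
  have -> : `|1 + s ^+ 2 / r ^+ 2| = (r ^+ 2 + s ^+ 2) / r ^+ 2.
    rewrite ger0_norm ?addr_ge0 ?divr_ge0 ?sqr_ge0//.
    by field; rewrite gt_eqF.
  rewrite mulrA ler_pdivrMr ?exprn_gt0// => h.
  apply: le_trans h; rewrite ler_wpM2l//.
  have := sqr_ge0 (r - s); nra.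
have hes : e <= 2 * s by have := normr_ge0 (Re z - 1 - s ^+ 2); lra.
set u := e / (2 * s).
have u01 : 0 <= u <= 1.
  by rewrite /u divr_ge0 ?mulr_ge0 ?(ltW s0)//= ler_pdivrMr ?mul1r ?mulr_gt0.
have h3 : `|Re G| <= (1 - u) * r.
  have -> : (1 - u) * r = ((2 * s - e) * r ^+ 2) / (2 * s * r).
    by rewrite /u; field; rewrite !gt_eqF.
  by rewrite ler_pdivlMr ?mulr_gt0.
have h4 : Re G ^+ 2 <= (1 - u) * r ^+ 2.
  rewrite -real_normK ?num_real//.
  have /andP[u0 u1] := u01.
  apply: (@le_trans _ _ (((1 - u) * r) ^+ 2)).
    by rewrite ler_pXn2r ?nnegrE// mulr_ge0 ?subr_ge0 ?(ltW Gn).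
  rewrite exprMn ler_wpM2r ?sqr_ge0//; nra.
have := modc_sqr G; rewrite -/r; lra.
Qed.

(** The factor [1 - l / (G1 G2)] is the difference quotient of [G + l / G].  It
    cannot be small because [G1] and [- l / G2] are both in the upper
    half-plane: [|G1 - l / G2| >= Im G1]. *)
Lemma joukowski_stable (k l : R) (G1 G2 : R[i]) : 0 <= l ->
  0 < Im G1 -> 0 < Im G2 -> k * modc G1 <= Im G1 ->
  k <= modc (1 - l%:C / (G1 * G2)).
Proof.
move=> l0 g1 g2 h.
have G1n : G1 != 0 by exact: Im_neq0.
have G2n : G2 != 0 by exact: Im_neq0.
have -> : 1 - l%:C / (G1 * G2) = (G1 - l%:C / G2) / G1 by field; rewrite G1n G2n.
rewrite Normc.normcM Normc.normcV ler_pdivlMr ?modc_gt0//.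
rewrite (le_trans h)// (le_trans _ (modc_Im _))// (le_trans _ (ler_norm _))//.
rewrite ImD ImN Im_realdiv opprK lerDl mulr_ge0 ?divr_ge0 ?sqr_ge0//.
exact: ltW.
Qed.

End Joukowski.

Section Approx.
Context {R : realType} (n : nat) (p : 'I_n -> R) (q lambda : R).
Hypothesis sp : sparse p q.
Let b i := bern_var (p i).
Let Lam := \sum_(i < n) p i.
Let d := sparse_error p q lambda.

Let q01 : 0 <= q <= 30^-1. Proof. by case: sp. Qed.
Let p01 i : 0 <= p i <= q ^+ 2. Proof. by have [_ + _] := sp; apply. Qed.
Let p_ge0 i : 0 <= p i. Proof. by case/andP: (p01 i). Qed.
Let b_ge0 i : 0 <= b i.
Proof. by have [/andP[]] := bern_var_bound q01 (p01 i). Qed.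
Let b_le i : b i <= p i.
Proof. by have [/andP[]] := bern_var_bound q01 (p01 i). Qed.
Let bpE i : (b i)%:C - (p i)%:C = - (p i ^+ 2)%:C :> R[i].
Proof. by rewrite -rmorphB -rmorphN; congr (_%:C); rewrite /b /bern_var; ring. Qed.
Let pp_le i : p i ^+ 2 <= q ^+ 2 * p i.
Proof. by rewrite expr2 ler_wpM2r//; case/andP: (p01 i). Qed.
Let p_small i : p i <= 900^-1.
Proof. by have [_ _ + _] := bern_var_bound q01 (p01 i). Qed.

Let sum_pp (c : R) (f : 'I_n -> R[i]) : 0 <= c ->
  (forall i, modc (f i) <= c * p i ^+ 2) ->
  modc (\sum_(i < n) f i) <= c * q ^+ 2 * Lam.
Proof.
move=> c0 hf; rewrite (le_trans (modc_sum _))// /Lam mulr_sumr.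
by apply: ler_sum => i _; rewrite (le_trans (hf i))// -mulrA ler_wpM2l ?pp_le.
Qed.

Let qL_ge0 : 0 <= q ^+ 2 * Lam.
Proof. by rewrite mulr_ge0 ?sqr_ge0// sumr_ge0. Qed.

Let invle (x : R[i]) (c : R) : 0 < c -> c <= modc x -> (modc x)^-1 <= c^-1.
Proof. by move=> c0 cx; rewrite lef_pV2 ?posrE// (lt_le_trans c0). Qed.

(** Replacing [b i / v i] by [p i / G] costs [O(p i ^ 2)], as [b i] is within
    [p i ^ 2] of [p i] and [v i] within [4 * p i] of [G]. *)
Lemma system_approx z G v : subordination_system p z G v ->
  modc (z - 1 - lambda%:C - (G + lambda%:C / G)) <= d.
Proof.
move=> sys; have [_ vi _ ez] := sys.
have Gp := system_Im_gt0 sp sys.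
have G0 : G != 0 by exact: Im_neq0.
have v0 i : v i != 0 by apply: Im_neq0; exact: vi.
have NG := modc_G_ge sp sys.
have -> : z - 1 - lambda%:C - (G + lambda%:C / G) =
    \sum_(i < n) ((b i)%:C / v i - (p i)%:C / G)
    + (Lam - lambda)%:C * (1 + G^-1).
  rewrite ez sumrB big_split/= -mulr_suml -!rmorph_sum -/Lam rmorphB/=.
  by rewrite mulrDr mulr1 mulrBl; ring.
have h1 : modc (\sum_(i < n) ((b i)%:C / v i - (p i)%:C / G)) <= 12 * q ^+ 2 * Lam.
  apply: sum_pp => // i.
  have -> : (b i)%:C / v i - (p i)%:C / G =
      ((b i)%:C - (p i)%:C) / v i + (p i)%:C * (G - v i) / (v i * G).
    by field; rewrite G0 v0.
  have hv := modc_root_ge sp sys i.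
  rewrite bpE (le_trans (modcD _ _))//.
  rewrite !(Normc.normcM, Normc.normcV) modcN !modcR !ger0_norm ?sqr_ge0//.
  have t1 : p i ^+ 2 / modc (v i) <= p i ^+ 2 * 2.
    by rewrite ler_wpM2l ?sqr_ge0// -[leRHS]invrK; apply: invle; lra.
  have t2 : p i * modc (G - v i) / (modc (v i) * modc G) <= p i ^+ 2 * 10.
    rewrite ler_pdivrMr ?mulr_gt0//; [|lra..].
    have -> : p i ^+ 2 * 10 * (modc (v i) * modc G) =
      p i * (4 * p i) * (5 / 2 * (modc (v i) * modc G)) by field.
    have h : p i * modc (G - v i) <= p i * (4 * p i).
      by rewrite ler_wpM2l// modc_distC (root_dist sp sys).
    rewrite (le_trans h)// ler_peMr ?mulr_ge0//; nra.
  lra.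
have h2 : modc ((Lam - lambda)%:C * (1 + G^-1)) <= 3 * `|Lam - lambda|.
  rewrite Normc.normcM modcR mulrC ler_wpM2r//.
  rewrite (le_trans (modcD _ _))// Normc.normc1 Normc.normcV.
  have := invle _ NG; lra.
rewrite (le_trans (modcD _ _))// /d /sparse_error -/Lam.
have := qL_ge0; lra.
Qed.

(** Subtracting the quadratic equations gives the exact difference quotient
    [z1 - z2 = (G1 - G2) * (1 - \sum_i b i / (v1 i * v2 i + b i))], and the sum
    is close to [lambda / (G1 G2)], where [joukowski_stable] applies. *)
Lemma system_lipschitz (k : R) z1 G1 v1 z2 G2 v2 :
  subordination_system p z1 G1 v1 -> subordination_system p z2 G2 v2 ->
  0 < k -> 0 <= lambda -> k * modc G1 <= Im G1 -> d <= k / 2 ->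
  modc (G1 - G2) <= 2 / k * modc (z1 - z2).
Proof.
move=> sys1 sys2 k0 l0 hk hd.
have [_ vi1 eG1 ez1] := sys1; have [_ vi2 eG2 ez2] := sys2.
have G1p := system_Im_gt0 sp sys1; have G2p := system_Im_gt0 sp sys2.
have G10 : G1 != 0 by exact: Im_neq0.
have G20 : G2 != 0 by exact: Im_neq0.
have v10 i : v1 i != 0 by apply: Im_neq0; exact: vi1.
have v20 i : v2 i != 0 by apply: Im_neq0; exact: vi2.
have N1 := modc_G_ge sp sys1; have N2 := modc_G_ge sp sys2.
pose W i := v1 i * v2 i + (b i)%:C.
have hW i : 5^-1 <= modc (W i).
  have := modcD (W i) (- (b i)%:C); rewrite /W addrK Normc.normcM modcN modcR.
  rewrite ger0_norm//; have := modc_root_ge sp sys1 i.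
  have := modc_root_ge sp sys2 i; have := p_small i; have := b_le i; nra.
have W0 i : W i != 0 by rewrite -modc_gt0 (lt_le_trans _ (hW i)).
pose S := \sum_(i < n) (b i)%:C / W i.
have ez : z1 - z2 = (G1 - G2) * (1 - S).
  have eb i : (b i)%:C / v1 i - (b i)%:C / v2 i
      = - ((G1 - G2) * ((b i)%:C / W i)).
    have -> : G1 - G2 = (v1 i - v2 i) * W i / (v1 i * v2 i).
      by rewrite (eG1 i) (eG2 i) /W -/(b i); field; rewrite v10 v20.
    by field; rewrite W0 v10 v20.
  rewrite mulrBr mulr1 /S mulr_sumr -sumrN -(eq_bigr _ (fun i _ => eb i)).
  by rewrite ez1 ez2 !big_split/= sumrN; ring.
have hS : modc (S - Lam%:C / (G1 * G2)) <= 100 * q ^+ 2 * Lam.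
  have -> : S - Lam%:C / (G1 * G2) =
      \sum_(i < n) ((b i)%:C / W i - (p i)%:C / (G1 * G2)).
    by rewrite sumrB -mulr_suml -rmorph_sum.
  apply: sum_pp => // i.
  (* G1 * G2 - v1 * v2 = G1 * (G2 - v2) + v2 * (G1 - v1) *)
  have -> : (b i)%:C / W i - (p i)%:C / (G1 * G2) =
      ((b i)%:C - (p i)%:C) / (G1 * G2) + (b i)%:C * ((G2 - v2 i) / (G2 * W i)
      + (v2 i / G2) * ((G1 - v1 i) / (G1 * W i)) - (b i)%:C / (W i * (G1 * G2))).
    by have := W0 i; rewrite /W => w0; field; rewrite G10 G20 w0.
  (* Each factor below is bounded through |G|^-1 <= 5/4 and |W|^-1 <= 5. *)
  have i1 : (modc G1)^-1 <= 5 / 4 by rewrite -[leRHS]invrK; apply: invle; lra.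
  have i2 : (modc G2)^-1 <= 5 / 4 by rewrite -[leRHS]invrK; apply: invle; lra.
  have iW : (modc (W i))^-1 <= 5 by rewrite -[leRHS]invrK; apply: invle.
  have i1' : 0 <= (modc G1)^-1 by rewrite invr_ge0 modc_ge0.
  have i2' : 0 <= (modc G2)^-1 by rewrite invr_ge0 modc_ge0.
  have iW' : 0 <= (modc (W i))^-1 by rewrite invr_ge0 modc_ge0.
  have i12 : (modc G1)^-1 * (modc G2)^-1 <= 25 / 16 by nra.
  have i12' : 0 <= (modc G1)^-1 * (modc G2)^-1 by rewrite mulr_ge0.
  have i1W : (modc G1)^-1 * (modc (W i))^-1 <= 25 / 4 by nra.
  have i2W : (modc G2)^-1 * (modc (W i))^-1 <= 25 / 4 by nra.
  have iW12 : (modc (W i))^-1 * ((modc G1)^-1 * (modc G2)^-1) <= 8 by nra.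
  have i1W' : 0 <= (modc G1)^-1 * (modc (W i))^-1 by rewrite mulr_ge0.
  have i2W' : 0 <= (modc G2)^-1 * (modc (W i))^-1 by rewrite mulr_ge0.
  have iW12' : 0 <= (modc (W i))^-1 * ((modc G1)^-1 * (modc G2)^-1).
    by rewrite mulr_ge0.
  have t1 : modc ((G2 - v2 i) / (G2 * W i)) <= 25 * p i.
    rewrite !(Normc.normcM, Normc.normcV) invfM modc_distC.
    have := root_dist sp sys2 i; have := p_ge0 i; have := modc_ge0 (v2 i - G2).
    nra.
  have t2 : modc ((G1 - v1 i) / (G1 * W i)) <= 25 * p i.
    rewrite !(Normc.normcM, Normc.normcV) invfM modc_distC.
    have := root_dist sp sys1 i; have := p_ge0 i; have := modc_ge0 (v1 i - G1).
    nra.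
  have t3 : modc (v2 i / G2) <= 2.
    rewrite !(Normc.normcM, Normc.normcV) ler_pdivrMr ?modc_gt0//.
    exact: (modc_root_le sp sys2).
  have t4 : modc ((b i)%:C / (W i * (G1 * G2))) <= 8 * p i.
    rewrite !(Normc.normcM, Normc.normcV) !invfM modcR ger0_norm//.
    have := b_le i; have := b_ge0 i; nra.
  have t5 : modc (((b i)%:C - (p i)%:C) / (G1 * G2)) <= 25 / 16 * p i ^+ 2.
    rewrite bpE !(Normc.normcM, Normc.normcV) invfM modcN modcR ger0_norm ?sqr_ge0//.
    by rewrite mulrC ler_wpM2r ?sqr_ge0.
  have t23 : modc (v2 i / G2 * ((G1 - v1 i) / (G1 * W i))) <= 50 * p i.
    rewrite Normc.normcM; move: t2 t3.
    have := modc_ge0 (v2 i / G2); have := modc_ge0 ((G1 - v1 i) / (G1 * W i)).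
    nra.
  rewrite (le_trans (modcD _ _))// [X in _ + X]Normc.normcM modcR ger0_norm//.
  set X := modc (_ + _ - _).
  have hX : X <= 83 * p i.
    by rewrite (le_trans (modcB _ _))//; have := modcD ((G2 - v2 i) / (G2 * W i))
     (v2 i / G2 * ((G1 - v1 i) / (G1 * W i))); lra.
  have : b i * X <= p i * (83 * p i) by rewrite ler_pM ?modc_ge0.
  move: t5; have := sqr_ge0 (p i); nra.
have hL : modc (Lam%:C / (G1 * G2) - lambda%:C / (G1 * G2)) <= 2 * `|Lam - lambda|.
  rewrite -mulrBl -rmorphB !(Normc.normcM, Normc.normcV) modcR mulrC.
  rewrite ler_wpM2r// -Normc.normcM -[leRHS]invrK.
  by apply: invle; rewrite ?invr_gt0// Normc.normcM; nra.
have hk1 := joukowski_stable l0 G1p G2p hk.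
have h1S : k / 2 <= modc (1 - S).
  have := modcD (1 - S) ((S - Lam%:C / (G1 * G2)) +
    (Lam%:C / (G1 * G2) - lambda%:C / (G1 * G2))).
  have -> : 1 - S + (S - Lam%:C / (G1 * G2) +
    (Lam%:C / (G1 * G2) - lambda%:C / (G1 * G2))) = 1 - lambda%:C / (G1 * G2).
    by ring.
  have := modcD (S - Lam%:C / (G1 * G2))
    (Lam%:C / (G1 * G2) - lambda%:C / (G1 * G2)).
  move: hd; rewrite /d /sparse_error -/Lam.
  have := qL_ge0; have := normr_ge0 (Lam - lambda); lra.
rewrite ez Normc.normcM mulrCA ler_peMr ?modc_ge0//.
have k2 : 2 / k * (k / 2) = 1 by field; rewrite gt_eqF.
rewrite -[leLHS]k2.
by rewrite ler_wpM2l// divr_ge0// ltW.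
Qed.

End Approx.

(** * Free convolutions of Bernoulli laws *)

Section StieltjesKernel.
Context {R : realType}.
Implicit Types (x a b : R) (z : R[i]).

Lemma Re_kernel x a b :
  Re ((x%:C - (a +i* b))^-1) = (x - a) / ((x - a) ^+ 2 + b ^+ 2).
Proof. by rewrite /= sub0r sqrrN. Qed.

Lemma Im_kernel x a b :
  Im ((x%:C - (a +i* b))^-1) = b / ((x - a) ^+ 2 + b ^+ 2).
Proof. by rewrite /= sub0r sqrrN mulNr opprK. Qed.

Lemma continuous_kernel_denom a b : b != 0 ->
  continuous (fun x : R => ((x - a) ^+ 2 + b ^+ 2)^-1).
Proof.
move=> b0 x; apply: cvgV.
  by rewrite gt_eqF// ltr_wpDl ?sqr_ge0// exprn_even_gt0.
apply: cvgD; last exact: cvg_cst.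
by rewrite expr2; apply: cvgM; (apply: cvgB; [exact: cvg_id|exact: cvg_cst]).
Qed.

Lemma measurable_Re_kernel z : 0 < Im z ->
  measurable_fun [set: measurableTypeR R] (fun x : R => Re ((x%:C - z)^-1)).
Proof.
case: z => a b b0; have {}b0 : 0 < b := b0; under eq_fun do rewrite Re_kernel.
apply: continuous_measurable_fun => x; apply: cvgM.
  by apply: cvgB; [exact: cvg_id|exact: cvg_cst].
by apply: continuous_kernel_denom; rewrite gt_eqF.
Qed.

Lemma measurable_Im_kernel z : 0 < Im z ->
  measurable_fun [set: measurableTypeR R] (fun x : R => Im ((x%:C - z)^-1)).
Proof.
case: z => a b b0; have {}b0 : 0 < b := b0; under eq_fun do rewrite Im_kernel.
apply: continuous_measurable_fun => x; apply: cvgM; first exact: cvg_cst.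
by apply: continuous_kernel_denom; rewrite gt_eqF.
Qed.

(** The integral of a nonnegative function transfers to the law on [bool]
    unconditionally; the general case is the difference of two such. *)
Lemma Rintegral_bernoulli_law (p : R) (f : R -> R) : 0 <= p <= 1 ->
  measurable_fun [set: measurableTypeR R] f ->
  (\int[bernoulli_law p]_x f x = p * f 1 + (1 - p) * f 0)%R.
Proof.
move=> p01 mf; have /andP[p0 p1] := p01.
have main (g : R -> R) : measurable_fun [set: measurableTypeR R] g ->
  (forall x, 0 <= g x) -> (\int[bernoulli_law p]_x (g x)%:E =
    (p * g 1 + (1 - p) * g 0)%:E)%E.
  move=> mg g0; rewrite /bernoulli_law ge0_integral_distribution//=.
  - by rewrite integral_bernoulli_prob//= => x; rewrite lee_fin.
  - exact/measurable_EFinP.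
rewrite /Rintegral integralE.
rewrite -[X in (X^\+)%E]/(EFin \o f) -[X in (X^\-)%E]/(EFin \o f) funerpos funerneg.
rewrite !main//; last 2 first.
- exact: measurable_funrneg.
- exact: measurable_funrpos.
have e x : f x = f^\+ x - f^\- x by rewrite -[in LHS](funrposBneg f).
by rewrite -EFinB /= (e 1) (e 0); ring.
Qed.

Lemma stieltjes_bernoulli (p : R) z : 0 <= p <= 1 -> 0 < Im z ->
  stieltjes (bernoulli_law p) z =
  p%:C * (1 - z)^-1 + (1 - p)%:C * (- z)^-1.
Proof.
move=> p01 z0; rewrite /stieltjes !Rintegral_bernoulli_law//.
- have -> : p%:C / (1 - z) + (1 - p)%:C / (- z) =
      p%:C * (1%:C - z)^-1 + (1 - p)%:C * (0%:C - z)^-1.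
    by rewrite rmorph1 rmorph0 sub0r.
  case: ((1%:C - z)^-1) ((0%:C - z)^-1) => [a b] [c e].
  by apply/eqP; rewrite eq_complex /= !mul0r !subr0 !addr0 !eqxx.
- exact: measurable_Im_kernel.
- exact: measurable_Re_kernel.
Qed.

End StieltjesKernel.

Section FreeSum.
Context {R : realType}.
Implicit Types (mu nu : real_law R) (z : R[i]).

Lemma eq_stieltjes mu nu z :
    (forall A : set (measurableTypeR R), measurable A -> mu A = nu A) ->
  stieltjes mu z = stieltjes nu z.
Proof.
by move=> munu; rewrite /stieltjes /Rintegral; congr (fine _ +i* fine _);
  apply: eq_measure_integral => A mA _; exact: munu.
Qed.

(** At a step [rho [+] nu] of the chain, the subordination functions of [rho] are
    composed with [w1], since the transform of [rho [+] nu] is that of [rho]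
    composed with [w1]; the relation [z - 1/m = w1 + w2] then adds one [-1/m]. *)
Lemma free_sum_subordination s mu : is_free_sum s mu ->
  forall z, 0 < Im z -> exists W : nat -> R[i],
  [/\ forall i, (i < size s)%N -> Im z <= Im (W i),
      forall i, (i < size s)%N -> stieltjes mu z = stieltjes (nth mu s i) (W i)
    & \sum_(i < size s) W i = z + ((size s)%:R - 1) * - (stieltjes mu z)^-1].
Proof.
elim=> {s mu} [mu nu munu z z0|s nu rho mu _ IH [w1 [w2 [sub1 sub2 conv]]] z z0].
  exists (fun=> z); split=> //=.
  - by case=> // _ /=; exact: eq_stieltjes.
  - by rewrite big_ord_recl big_ord0 subrr mul0r.
have [_ up1 _] := sub1; have [_ up2 _] := sub2.
have [e1 e2 e3] := conv z z0.
have [W [hW1 hW2 hW3]] := IH (w1 z) (lt_le_trans z0 (up1 z z0)).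
exists (fun i => if (i < size s)%N then W i else w2 z); rewrite size_rcons.
split.
- move=> i; rewrite ltnS leq_eqVlt => /predU1P[->|h]; first by rewrite ltnn up2.
  by rewrite h (le_trans (up1 z z0))// hW1.
- move=> i; rewrite ltnS leq_eqVlt nth_rcons => /predU1P[->|h].
    by rewrite ltnn eqxx.
  by rewrite h e1 (hW2 i h) (set_nth_default mu).
- rewrite big_ord_recr/= ltnn.
  under eq_bigr do rewrite ltn_ord.
  rewrite hW3 -e1 -[in RHS]natr1 addrK.
  have -> : w2 z = z - (stieltjes mu z)^-1 - w1 z by rewrite e3; ring.
  by ring.
Qed.

(** The transform of the Bernoulli law at [W] is [(W - 1 + p) / (W (1 - W))],
    whose negative inverse is [v + 1 - 2 p - b / v] for [v = W - 1 + p]. *)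
Lemma bernoulli_sum_system n (p : 'I_n -> R) mu z :
    (forall i, 0 <= p i <= 1) ->
    is_free_sum [seq bernoulli_law (p i) | i : 'I_n] mu -> 0 < Im z ->
  exists v, subordination_system p z (- (stieltjes mu z)^-1 - 1) v.
Proof.
move=> p01 hmu z0.
have sz : size [seq bernoulli_law (p i) | i : 'I_n] = n.
  by rewrite size_map size_enum_ord.
have [W []] := free_sum_subordination hmu z0; rewrite sz => hW1 hW2 hW3.
set m := stieltjes mu z in hW2 hW3 *.
have W0 (i : 'I_n) : 0 < Im (W i) by rewrite (lt_le_trans z0)// hW1.
have mE (i : 'I_n) : m = (p i)%:C * (1 - W i)^-1 + (1 - p i)%:C * (- W i)^-1.
  rewrite (hW2 i (ltn_ord i)) (nth_map i) ?size_enum_ord// nth_ord_enum.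
  exact: stieltjes_bernoulli.
have Wn0 (i : 'I_n) : W i != 0 by exact: Im_neq0.
have Wn1 (i : 'I_n) : 1 - W i != 0.
  rewrite -oppr_eq0 opprB; apply: Im_neq0.
  by rewrite ImD ImN /= oppr0 addr0.
pose v (i : 'I_n) : R[i] := W i - 1 + (p i)%:C.
have v0 i : 0 < Im (v i) by rewrite /v !ImD ImN /= oppr0 !addr0.
have vn0 i : v i != 0 by exact: Im_neq0.
have GE i : - m^-1 - 1 = v i - (p i *+ 2)%:C - (bern_var (p i))%:C / v i.
  have -> : m = v i / (W i * (1 - W i)).
    rewrite (mE i) /v rmorphB rmorph1; field.
    by rewrite Wn0 Wn1.
  rewrite /bern_var rmorphM rmorphB rmorph1 mulr2n rmorphD /=.
  have -> : (W i) = v i + 1 - (p i)%:C by rewrite /v; ring.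
  field.
  rewrite vn0 /=.
  have -> : v i + 1 - (p i)%:C = W i by rewrite /v; ring.
  by rewrite Wn0 Wn1.
exists v; split => //.
(* p i + b i / v i is omega_i - F, and the omega_i sum to z + (n - 1) F. *)
rewrite (eq_bigr (fun i : 'I_n => W i - - m^-1)).
  by rewrite sumrB hW3 sumr_const card_ord -[_ *+ n]mulr_natl; ring.
move=> i _; have -> : (bern_var (p i))%:C / v i = v i - (p i *+ 2)%:C - (- m^-1 - 1).
  by rewrite (GE i); ring.
by rewrite /v mulr2n rmorphD /=; ring.
Qed.

End FreeSum.

(** * Boundary values and the Poisson kernel *)

Section RightLimit.
Context {R : realType}.
Implicit Types (f : R -> R) (L : R).

(** A Lipschitz function on the open half-line is Cauchy at its end point. *)
Lemma lipschitz_right_limit f L : 0 <= L ->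
    (forall y y', 0 < y -> 0 < y' -> `|f y - f y'| <= L * `|y - y'|) ->
  cvg (f @ 0^'+) /\ forall y, 0 < y -> `|f y - lim (f @ 0^'+)| <= L * y.
Proof.
move=> L0 hf.
have cf : cvg (f @ 0^'+).
  apply/cauchy_cvgP/cauchy_exP => e e0.
  pose del := e / (L + 1).
  have del0 : 0 < del by rewrite divr_gt0// ltr_wpDl.
  exists (f del).
  suff : \forall y \near 0^'+, `|f del - f y| < e by [].
  near=> y.
  have y0 : 0 < y by near: y; exact: nbhs_right_gt.
  have yd : y < del by near: y; exact: nbhs_right_lt.
  apply: le_lt_trans (hf _ _ del0 y0) _.
  rewrite gtr0_norm ?subr_gt0//.
  have e1 : e = (L + 1) * del by rewrite /del; field; rewrite gt_eqF// ltr_wpDl.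
  have h1 : L * (del - y) <= L * del by rewrite ler_wpM2l// gerBl ltW.
  by rewrite (le_lt_trans h1)// e1 mulrDl mul1r ltrDl.
split => // y y0.
have near_y : \forall y' \near 0^'+, f y - L * y <= f y' <= f y + L * y.
  near=> y'.
  have y'0 : 0 < y' by near: y'; exact: nbhs_right_gt.
  have y'y : y' < y by near: y'; exact: nbhs_right_lt.
  have := hf _ _ y0 y'0; rewrite (gtr0_norm (_ : 0 < y - y')) ?subr_gt0//.
  have h1 : L * (y - y') <= L * y by rewrite ler_wpM2l// gerBl ltW.
  rewrite ler_norml => /andP[h2 h3]; apply/andP; split; lra.
have h1 : lim (f @ 0^'+) <= f y + L * y.
  by apply: limr_le => //; apply: filterS near_y => ? /andP[].
have h2 : f y - L * y <= lim (f @ 0^'+).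
  by apply: limr_ge => //; apply: filterS near_y => ? /andP[].
by rewrite ler_norml; apply/andP; split; lra.
Unshelve. all: by end_near. Qed.

End RightLimit.

Section PoissonKernel.
Context {R : realType}.
Implicit Types (x y t c d : R).

(** The Poisson kernel of the upper half-plane, up to the factor [pi]. *)
Definition poisson y s : R := y / (s ^+ 2 + y ^+ 2).

Lemma poisson_denom_gt0 y s : 0 < y -> 0 < s ^+ 2 + y ^+ 2.
Proof. by move=> y0; rewrite ltr_wpDl ?sqr_ge0// exprn_gt0. Qed.

Lemma poisson_ge0 y s : 0 < y -> 0 <= poisson y s.
Proof. by move=> y0; rewrite divr_ge0 ?ltW// poisson_denom_gt0. Qed.

Lemma poisson_le y s : 0 < y -> poisson y s <= y^-1.
Proof.
move=> y0; rewrite /poisson ler_pdivrMr ?poisson_denom_gt0//.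
by rewrite ler_pdivlMl// -expr2 lerDr sqr_ge0.
Qed.

Lemma continuous_poisson y : 0 < y -> continuous (poisson y).
Proof.
move=> y0 s; apply: cvgM; first exact: cvg_cst.
apply: cvgV; first by rewrite gt_eqF// poisson_denom_gt0.
by apply: cvgD; [rewrite expr2; apply: cvgM|exact: cvg_cst].
Qed.

Lemma measurable_poisson y : 0 < y ->
  measurable_fun [set: measurableTypeR R] (poisson y).
Proof. by move=> y0; apply: continuous_measurable_fun; exact: continuous_poisson. Qed.

Lemma measurable_poisson_shift y x : 0 < y ->
  measurable_fun [set: measurableTypeR R] (fun t => poisson y (t - x)).
Proof.
move=> y0; apply: (measurableT_comp (measurable_poisson y0)).
by apply: measurable_funB.
Qed.

Lemma integral_poisson y t c d : 0 < y -> c < d ->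
  (\int[lebesgue_measure]_(x in `[c, d]) (poisson y (t - x))%:E =
   (atan ((d - t) / y) - atan ((c - t) / y))%:E)%E.
Proof.
move=> y0 cd.
have dF x : is_derive x 1 (fun x => atan ((x - t) / y)) (poisson y (t - x)).
  have h : is_derive x 1 (fun x => (x - t) / y) y^-1.
    rewrite (_ : (fun x => (x - t) / y) = y^-1 \*: (shift (- t))); last first.
      by apply/funext => ?; rewrite /= mulrC.
    have := is_deriveZ y^-1 (is_derive_shift x 1 (- t)).
    by move=> h; apply: is_derive_eq h _; rewrite scaler1.
  have h2 := @is_derive1_comp _ atan (fun x => (x - t) / y) x _ _
    (is_derive1_atan _) h.
  apply: is_derive_eq h2 _; rewrite /poisson.
  have e : t - x = - (x - t) by rewrite opprB.
  rewrite e sqrrN; field.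
  by rewrite !gt_eqF// ?ltr_wpDl ?sqr_ge0 ?exprn_gt0.
have cF : continuous (fun x => atan ((x - t) / y)).
  by move=> x; apply: differentiable_continuous; apply/derivable1_diffP; case: (dF x).
rewrite (@continuous_FTC2 _ _ (fun x => atan ((x - t) / y)))//.
- apply: continuous_subspaceT => x.
  apply: (@continuous_comp _ _ _ (fun x : R => t - x) (poisson y)).
    2: exact: continuous_poisson.
  by apply: cvgB; [exact: cvg_cst|exact: cvg_id].
- split => //.
  + by apply: cvg_at_right_filter; exact: cF.
  + by apply: cvg_at_left_filter; exact: cF.
- by move=> x _; rewrite derive1E; case: (dF x).
Qed.

End PoissonKernel.

Section StieltjesPoisson.
Context {R : realType}.
Variable mu : real_law R.
Local Notation h x y := (Im (stieltjes mu (x +i* y))).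

Lemma Im_stieltjes_poisson x y : 0 < y ->
  ((h x y)%:E = \int[mu]_t (poisson y (t - x))%:E)%E.
Proof.
move=> y0.
have -> : h x y = fine (\int[mu]_t (poisson y (t - x))%:E).
  rewrite -[LHS]/(fine (\int[mu]_t (Im ((t%:C - (x +i* y))^-1))%:E)).
  by congr fine; apply: eq_integral => t _; rewrite Im_kernel.
rewrite fineK// ge0_fin_numE; last first.
  by apply: integral_ge0 => t _; rewrite lee_fin poisson_ge0.
apply: (@le_lt_trans _ _ (\int[mu]_t (y^-1)%:E)%E).
  apply: ge0_le_integral => //.
  - by move=> t _; rewrite lee_fin poisson_ge0.
  - by apply/measurable_EFinP; exact: measurable_poisson_shift.
  - by move=> t _; rewrite lee_fin poisson_le.
rewrite integral_cst// [X in (_ * X)%E](_ : _ = 1%E) ?mule1 ?ltry//.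
exact: probability_setT.
Qed.

Lemma Im_stieltjes_ge0 x y : 0 < y -> 0 <= h x y.
Proof.
move=> y0; rewrite -lee_fin Im_stieltjes_poisson//.
by apply: integral_ge0 => t _; rewrite lee_fin poisson_ge0.
Qed.

(** The kernel equals [1 / y] at its centre. *)
Lemma atom_le x y : 0 < y -> (mu [set x] <= (y * h x y)%:E)%E.
Proof.
move=> y0; rewrite EFinM Im_stieltjes_poisson//.
rewrite -ge0_integralZl_EFin ?(ltW y0)//; last 2 first.
- by move=> t _; rewrite lee_fin poisson_ge0.
- by apply/measurable_EFinP; exact: measurable_poisson_shift.
rewrite -(setIT [set x]) -integral_indic//.
apply: ge0_le_integral => //.
- by apply/measurable_EFinP; exact: measurable_indic.
- apply/measurable_EFinP; apply: measurable_funM => //.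
  exact: measurable_poisson_shift.
- move=> t _; rewrite -EFinM lee_fin indicE; have [|_] := boolP (t \in _).
    rewrite inE /= => ->; rewrite subrr /poisson expr0n /= add0r.
    by rewrite mulrA -expr2 divff// gt_eqF// exprn_gt0.
  by rewrite mulr_ge0 ?poisson_ge0// ltW.
Qed.

(** Tonelli: the kernel is symmetric in the point of the line and the variable
    of integration, and its primitive is an arctangent. *)
Lemma integral_Im_stieltjes y c d : 0 < y -> c < d ->
  (\int[lebesgue_measure]_(x in `[c, d]) (h x y)%:E =
   \int[mu]_t (atan ((d - t) / y) - atan ((c - t) / y))%:E)%E.
Proof.
move=> y0 cd.
under eq_integral do rewrite Im_stieltjes_poisson//.
rewrite integral_mkcond.
pose f (u : measurableTypeR R * measurableTypeR R) : \bar R :=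
  (poisson y (u.2 - u.1) * \1_`[c, d] u.1)%:E.
have mf : measurable_fun [set: measurableTypeR R * measurableTypeR R] f.
  apply/measurable_EFinP; apply: measurable_funM.
    by apply: (measurableT_comp (measurable_poisson y0)); exact: measurable_funB.
  by apply: measurableT_comp => //; exact: measurable_indic.
have f0 u : (0 <= f u)%E by rewrite /f lee_fin mulr_ge0 ?poisson_ge0.
transitivity (\int[lebesgue_measure]_x \int[mu]_t f (x, t))%E.
  apply: eq_integral => x _; rewrite patchE /f /= indicE.
  case: ifPn => xcd.
    by apply: eq_integral => t _; rewrite mulr1.
  by under eq_integral do rewrite mulr0; rewrite integral0.
rewrite fubini_tonelli//.
apply: eq_integral => t _.
rewrite -integral_poisson// [RHS]integral_mkcond.
apply: eq_integral => x _; rewrite patchE /f /= indicE.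
by case: ifPn => _; rewrite ?mulr1 ?mulr0.
Qed.

End StieltjesPoisson.

(** * Stieltjes inversion *)

Section AtanLimit.
Context {R : realType}.

Let cvg_scaled (s : R) : 0 < s -> atan (s * n.+1%:R) @[n --> \oo] --> pi / 2.
Proof.
move=> s0; have h : (s * n.+1%:R) @[n --> \oo] --> +oo.
  apply/cvgryPge => A; near=> n.
  rewrite mulrC -ler_pdivrMr// (@le_trans _ _ n%:R)// ?ler_nat//.
  by near: n; exact: nbhs_infty_ger.
exact: (cvg_comp _ _ h (@cvgy_atan R)).
Unshelve. all: by end_near. Qed.

Lemma cvg_atan_scaled (s : R) : s != 0 ->
  atan (s * n.+1%:R) @[n --> \oo] --> Num.sg s * (pi / 2).
Proof.
move=> s0; have [sp|sn|/eqP] := ltgtP 0 s; last by rewrite eq_sym (negbTE s0).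
  by rewrite gtr0_sg// mul1r; exact: cvg_scaled.
rewrite ltr0_sg// mulN1r.
rewrite (_ : (fun n => _) = fun n => - atan (- s * n.+1%:R)).
  by apply: cvgN; apply: cvg_scaled; rewrite oppr_gt0.
by apply/funext => n; rewrite mulNr atanN opprK.
Qed.

(** These are the integrals of the Poisson kernel over [[c, d]] for [y = 1 / n.+1];
    the end points are excluded because the limit there is [pi / 2]. *)
Lemma cvg_atan_window (c d t : R) : c <= d -> t != c -> t != d ->
  (atan ((d - t) * n.+1%:R) - atan ((c - t) * n.+1%:R)) @[n --> \oo] -->
    pi * \1_`[c, d] t.
Proof.
move=> cd tc td.
have -> : pi * \1_`[c, d] t =
    Num.sg (d - t) * (pi / 2) - Num.sg (c - t) * (pi / 2) :> R.
  rewrite indicE mem_setE in_itv /=; case: (boolP (c <= t <= d)).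
    move=> /andP[ct dt].
    rewrite gtr0_sg ?subr_gt0 1?lt_neqAle ?td// ltr0_sg; first by rewrite mulr1; field.
    by rewrite subr_lt0 lt_neqAle eq_sym tc.
  rewrite negb_and -!ltNge mulr0 => /orP[h|h].
    by rewrite !gtr0_sg ?subr_gt0// ?(lt_le_trans h)// subrr.
  by rewrite !ltr0_sg ?subr_lt0// ?(le_lt_trans cd)// subrr.
by apply: cvgB; apply: cvg_atan_scaled; rewrite subr_eq0 eq_sym.
Qed.

End AtanLimit.

Section StieltjesInversion.
Context {R : realType}.
Variables (mu : real_law R) (a b L : R).
Local Notation h x y := (Im (stieltjes mu (x +i* y))).
Local Notation leb := (@lebesgue_measure R).
Hypothesis L0 : 0 <= L.
Hypothesis hL : forall x x' y y', a <= x <= b -> a <= x' <= b ->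
  0 < y -> 0 < y' -> `|h x y - h x' y'| <= L * (`|x - x'| + `|y - y'|).

Let h0 x : R := lim (h x y @[y --> 0^'+]).

Let hlim x : a <= x <= b ->
  cvg (h x y @[y --> 0^'+]) /\ forall y, 0 < y -> `|h x y - h0 x| <= L * y.
Proof.
move=> xab; apply: (@lipschitz_right_limit _ (fun y => h x y)) => // y y' y0 y'0.
by have := hL xab xab y0 y'0; rewrite subrr normr0 add0r.
Qed.

Let h0_lip x x' : a <= x <= b -> a <= x' <= b -> `|h0 x - h0 x'| <= L * `|x - x'|.
Proof.
move=> xab x'ab; apply/ler_addgt0Pr => e e0.
pose y := e / (2 * L + 1).
have L1 : 0 < 2 * L + 1 by rewrite ltr_wpDl// mulr_ge0.
have y0 : 0 < y by rewrite divr_gt0.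
have ey : e = (2 * L + 1) * y by rewrite /y; field; rewrite gt_eqF.
have [_ /(_ _ y0) h1] := hlim xab; have [_ /(_ _ y0) h2] := hlim x'ab.
have := hL xab x'ab y0 y0; rewrite subrr normr0 addr0 => h3.
rewrite distrC in h1.
rewrite ey; move: (h x y) (h x' y) (h0 x) (h0 x') (`|x - x'|) h1 h2 h3.
move=> A B C D E h1 h2 h3.
have := ler_normD (C - A) (A - B); rewrite [C - A + _]addrA subrK.
have := ler_normD (C - B) (B - D); rewrite [C - B + _]addrA subrK.
lra.
Qed.

Let h0_ge0 x : a <= x <= b -> 0 <= h0 x.
Proof.
move=> /hlim[hc _]; apply: limr_ge => //; near=> y.
by apply: Im_stieltjes_ge0; near: y; exact: nbhs_right_gt.
Unshelve. all: by end_near. Qed.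

Let Lle y : y <= 1 -> L * y <= L.
Proof. by move=> y1; rewrite -[leRHS]mulr1 ler_wpM2l. Qed.

(** Im m stays bounded as [y] tends to 0, so [y * Im m] tends to 0. *)
Let atom0 x : a <= x <= b -> mu [set x] = 0%E.
Proof.
move=> xab; apply/eqP; rewrite eq_le measure_ge0 andbT.
apply/lee_addgt0Pr => e e0; rewrite add0e.
have C0 : 0 <= h0 x + L by rewrite addr_ge0// h0_ge0.
pose y := Num.min 1 (e / (h0 x + L + 1)).
have y0 : 0 < y by rewrite lt_min ltr01 divr_gt0// ltr_wpDl.
have y1 : y <= 1 by rewrite ge_min lexx.
have ye : y <= e / (h0 x + L + 1) by rewrite ge_min lexx orbT.
apply: (le_trans (atom_le mu x y0)); rewrite lee_fin.
have [_ /(_ _ y0)] := hlim xab; rewrite ler_norml => /andP[_ h1].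
have h2 : h x y <= h0 x + L + 1.
  by move: h1 (Lle y1); move: (h x y) (h0 x) => A B; lra.
move: ye; rewrite ler_pdivlMr ?ltr_wpDl//; apply: le_trans.
by rewrite ler_wpM2l// ltW.
Qed.

(** Precomposition with [clamp] makes a function that is continuous on [[a, b]]
    continuous on the line, hence measurable. *)
Let clamp x := Num.max a (Num.min x b).

Let clamp_id x : a <= x <= b -> clamp x = x.
Proof. by move=> /andP[ax xb]; rewrite /clamp min_l// max_r. Qed.

Section Nonempty.
Hypothesis ab : a <= b.

Let clamp_in x : a <= clamp x <= b.
Proof. by rewrite /clamp le_max lexx /= ge_max ab ge_min lexx orbT. Qed.

Let continuous_clamp : continuous clamp.
Proof.
move=> x; apply: (@continuous_max _ _ (cst a) (fun x : R => Num.min x b) x).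
  exact: cvg_cst.
apply: (@continuous_min _ _ id (cst b) x); [exact: cvg_id|exact: cvg_cst].
Qed.

Let continuous_lip (f : R -> R) : (forall x x', a <= x <= b -> a <= x' <= b ->
  `|f x - f x'| <= L * `|x - x'|) -> continuous (f \o clamp).
Proof.
move=> hf x; apply/cvgrPdist_lt => e e0.
have L1 : 0 < L + 1 by rewrite ltr_wpDl.
have : \forall y \near x, `|clamp x - clamp y| < e / (L + 1).
  by have /cvgrPdist_lt := continuous_clamp (x := x); apply; rewrite divr_gt0.
apply: filterS => y hy; apply: (le_lt_trans (hf _ _ (clamp_in x) (clamp_in y))).
have h1 : L * `|clamp x - clamp y| <= (L + 1) * `|clamp x - clamp y|.
  by rewrite ler_wpM2r// lerDl.
by rewrite (le_lt_trans h1)// mulrC -ltr_pdivlMr.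
Qed.

Let measurable_lip (f : R -> R) : (forall x x', a <= x <= b -> a <= x' <= b ->
    `|f x - f x'| <= L * `|x - x'|) ->
  measurable_fun [set: measurableTypeR R] (f \o clamp).
Proof. by move=> hf; apply: continuous_measurable_fun; exact: continuous_lip. Qed.

Let y_ (n : nat) : R := n.+1%:R^-1.
Let y_gt0 n : 0 < y_ n. Proof. by rewrite invr_gt0. Qed.
Let y_le1 n : y_ n <= 1. Proof. by rewrite invf_le1// ler1n. Qed.

Let in_ab c d x : a <= c -> d <= b -> x \in `[c, d] -> a <= x <= b.
Proof.
move=> ac db; rewrite in_itv /= => /andP[cx xd].
by rewrite (le_trans ac)//= (le_trans xd).
Qed.

Let h_le x y : a <= x <= b -> 0 < y -> y <= 1 ->
  h x y <= h0 a + L * (b - a) + L.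
Proof.
move=> xab y0 y1; have aab : a <= a <= b by rewrite lexx.
have [_ /(_ _ y0) h1] := hlim xab; have h2 := h0_lip xab aab.
move: (h x y) (h0 x) (h0 a) h1 h2 => A B C h1 h2.
have /andP[ax xb] := xab.
rewrite (ger0_norm (_ : 0 <= x - a)) ?subr_ge0// in h2.
have h4 : L * (x - a) <= L * (b - a) by rewrite ler_wpM2l// lerB.
have := ler_norm (A - B); have := ler_norm (B - C); have := Lle y1; lra.
Qed.

(** Both sides are the limit, as [y] tends to 0, of the integral of
    [Im m (x + iy)] over [[c, d]]: on the left the integrand converges
    uniformly, on the right the integral is [integral_Im_stieltjes].  The absence of atoms
    takes care of the end points. *)
Let interval_density c d : a <= c -> c < d -> d <= b ->
  (\int[leb]_(x in `[c, d]) (h0 (clamp x))%:E = pi%:E * mu [set` `[c, d]])%E.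
Proof.
move=> ac cd db.
have mI : measurable ([set` `[c, d]] : set (measurableTypeR R)) by [].
have mh n : measurable_fun [set: measurableTypeR R] (fun x => h (clamp x) (y_ n)).
  apply: (@measurable_lip (fun x => h x (y_ n))) => x x' xab x'ab.
  by have := hL xab x'ab (y_gt0 n) (y_gt0 n); rewrite subrr normr0 addr0.
have mh0 : measurable_fun [set: measurableTypeR R] (fun x => h0 (clamp x)).
  exact: (measurable_lip h0_lip).
pose M := h0 a + L * (b - a) + L.
have cvg1 : (\int[leb]_(x in `[c, d]) (h (clamp x) (y_ n))%:E @[n --> \oo] -->
    \int[leb]_(x in `[c, d]) (h0 (clamp x))%:E)%E.
  have [] := @dominated_convergence _ _ _ leb _ mI
    (fun n x => (h (clamp x) (y_ n))%:E) (fun x => (h0 (clamp x))%:E)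
    (fun=> M%:E) => //.
  - by move=> n; apply: measurable_funTS; apply/measurable_EFinP.
  - by apply: measurable_funTS; apply/measurable_EFinP.
  - apply/aeW => x _; apply: cvg_EFin; first exact: nearW.
    apply/cvgrPdist_le => e e0.
    have [_ hx] := hlim (clamp_in x).
    have := near_infty_natSinv_lt (PosNum (divr_gt0 e0 (ltr_wpDl L0 ltr01))).
    apply: filterS => n /= hn; rewrite distrC.
    apply: (le_trans (hx _ (y_gt0 n))).
    move: hn; rewrite ltr_pdivlMr ?ltr_wpDl// => /ltW; apply: le_trans.
    by rewrite mulrC ler_wpM2l ?(ltW (y_gt0 n))// lerDl.
  - apply/integrableP; split; first exact: measurable_cst.
    rewrite integral_cst//= lebesgue_measure_itv /= lte_fin cd.
    by rewrite -EFinD -EFinM ltry.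
  - apply/aeW => x n _; rewrite /= lee_fin ger0_norm; last exact: Im_stieltjes_ge0.
    exact: (h_le (clamp_in x) (y_gt0 n) (y_le1 n)).
have mI' : measurable [set: measurableTypeR R] by [].
pose k n t := atan ((d - t) / y_ n) - atan ((c - t) / y_ n).
have mk n : measurable_fun [set: measurableTypeR R] (k n).
  apply: continuous_measurable_fun => t.
  apply: cvgB.
    apply: (@continuous_comp _ _ _ (fun t => (d - t) / y_ n) atan).
      2: exact: continuous_atan.
    by apply: cvgM; [apply: cvgB; [exact: cvg_cst|exact: cvg_id]|exact: cvg_cst].
  apply: (@continuous_comp _ _ _ (fun t => (c - t) / y_ n) atan).
    2: exact: continuous_atan.
  by apply: cvgM; [apply: cvgB; [exact: cvg_cst|exact: cvg_id]|exact: cvg_cst].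
have cvg2 : (\int[mu]_t (k n t)%:E @[n --> \oo] -->
    \int[mu]_t (pi * \1_`[c, d] t)%:E)%E.
  have [] := @dominated_convergence _ _ _ mu _ mI'
    (fun n t => (k n t)%:E) (fun t => (pi * \1_`[c, d] t)%:E) (fun=> pi%:E) => //.
  - by move=> n; apply/measurable_EFinP.
  - by apply/measurable_EFinP; apply: measurable_funM.
  - exists ([set c] `|` [set d]); split.
    + by apply: measurableU; exact: measurable_set1.
    + apply: null_set_setU; try exact: measurable_set1.
        by apply: atom0; rewrite ac (le_trans (ltW cd)).
      by apply: atom0; rewrite db (le_trans ac)// ltW.
    + move=> t /= nt; apply: contrapT => /not_orP[tc td]; apply: nt => _.
      apply: cvg_EFin; first exact: nearW.
      have w := cvg_atan_window (ltW cd) (introN eqP tc) (introN eqP td).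
      by apply: cvg_trans w; apply: near_eq_cvg; apply: nearW => n /=;
        rewrite /k /y_ invrK.
  - apply/integrableP; split; first exact: measurable_cst.
    rewrite integral_cst//= [X in (_ * X)%E](_ : _ = 1%E) ?mule1 ?ltry//.
    exact: probability_setT.
  - apply/aeW => t n _; rewrite /= lee_fin /k.
    have := atan_ltpi2 ((d - t) / y_ n); have := atan_gtNpi2 ((d - t) / y_ n).
    have := atan_ltpi2 ((c - t) / y_ n); have := atan_gtNpi2 ((c - t) / y_ n).
    by move=> ? ? ? ?; rewrite ler_norml; apply/andP; split; lra.
have e12 n : (\int[leb]_(x in `[c, d]) (h (clamp x) (y_ n))%:E =
    \int[mu]_t (k n t)%:E)%E.
  apply: etrans (integral_Im_stieltjes mu (y_gt0 n) cd); apply: eq_integral => x.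
  rewrite mem_setE => xcd; have e := clamp_id (in_ab ac db xcd).
  by congr EFin; congr (Im (stieltjes mu (_ +i* _))).
have -> : (pi%:E * mu [set` `[c, d]] = \int[mu]_t (pi * \1_`[c, d] t)%:E)%E.
  under eq_integral do rewrite EFinM.
  rewrite ge0_integralZl_EFin ?pi_ge0//; first by rewrite integral_indic// setIT.
  by apply/measurable_EFinP; exact: measurable_indic.
have E := funext e12; rewrite E in cvg1.
exact: (cvg_unique _ cvg1 cvg2).
Qed.

Let J : set (measurableTypeR R) := [set` `[a, b]].
Let dens : measurableTypeR R -> \bar R :=
  (fun x => (pi^-1 * h0 (clamp x))%:E) \_ J.

Let dens_ge0 x : (0 <= dens x)%E.
Proof.
rewrite /dens patchE; case: ifPn => // _.
by rewrite lee_fin mulr_ge0 ?invr_ge0 ?pi_ge0// h0_ge0.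
Qed.

Let measurable_dens : measurable_fun [set: measurableTypeR R] dens.
Proof.
apply/(measurable_restrictT _ _).1; first exact: measurable_itv.
apply: measurable_funTS.
apply/measurable_EFinP; apply: measurable_funM => //.
exact: (measurable_lip h0_lip).
Qed.

Let density_measure (A : set (measurableTypeR R)) : \bar R :=
  (\int[leb]_(x in A) dens x)%E.

Let density_measure0 : density_measure set0 = 0%E.
Proof. exact: integral_set0. Qed.

Let density_measure_ge0 A : (0 <= density_measure A)%E.
Proof. by apply: integral_ge0 => x _; exact: dens_ge0. Qed.

Let density_measure_sigma_additive : semi_sigma_additive density_measure.
Proof. exact: semi_sigma_additive_nng_induced. Qed.

HB.instance Definition _ := isMeasure.Build _ _ _ density_measure
  density_measure0 density_measure_ge0 density_measure_sigma_additive.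

(** Two finite measures that agree on the rays [[x, +oo[]; intersected with
    [[a, b]] a ray is an interval ending at [b]. *)
Let density_measureE A : measurable A -> mu (A `&` J) = density_measure A.
Proof.
move=> mA.
have mJ : measurable J by exact: measurable_itv.
have ray x : mu ([set` `[x, +oo[] `&` J) = density_measure [set` `[x, +oo[].
  rewrite /density_measure /dens -integral_mkcondr.
  have -> : [set` `[x, +oo[] `&` J = [set` `[Num.max x a, b]].
    apply/seteqP; split=> y; rewrite /J /=.
      by rewrite !in_itv/= andbT => -[xy /andP[ay yb]]; rewrite ge_max xy ay yb.
    by rewrite !in_itv/= andbT ge_max => /andP[/andP[-> ->] ->].
  have [cb|bc|->] := ltgtP (Num.max x a) b.
  - have ac : a <= Num.max x a by rewrite le_max lexx orbT.
    under eq_integral do rewrite EFinM.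
    rewrite ge0_integralZl_EFin ?invr_ge0 ?pi_ge0//; first last.
    + apply: measurable_funTS; apply/measurable_EFinP; exact: (measurable_lip h0_lip).
    + by move=> y _; rewrite lee_fin h0_ge0.
    by rewrite interval_density// muleA -EFinM mulVf ?mul1e// gt_eqF// pi_gt0.
  - by rewrite set_itv_ge ?measure0 ?integral_set0// bnd_simp -ltNge.
  - rewrite set_itv1 integral_set1 atom0 ?lexx ?ab//.
pose nu1 : {measure set (measurableTypeR R) -> \bar R} := mrestr mu mJ.
pose nu2 : {measure set (measurableTypeR R) -> \bar R} := density_measure.
suff : nu1 A = nu2 A by [].
apply: (@measure_unique _ R (measurableTypeR R) (@RGenCInfty.G R)
  (fun n => [set` `[- n%:R, +oo[])) => //.
- exact: RGenCInfty.measurableE.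
- move=> _ _ [x ->] [y ->]; exists (Num.max x y).
  by apply/seteqP; split=> z /=; rewrite !in_itv /= !andbT ge_max => /andP.
- by move=> n; exists (- n%:R).
- apply/seteqP; split=> // x _; exists (Num.bound `|x|) => //=.
  rewrite in_itv /= andbT lerNl (le_trans (ler_norm _))// normrN.
  by rewrite ltW// archi_boundP.
- by move=> _ [x ->]; exact: ray.
- move=> n; rewrite /= /mrestr (@le_lt_trans _ _ 1%E) ?ltry//.
  by apply: probability_le1; apply: measurableI => //; exact: measurable_itv.
Qed.

Lemma stieltjes_inversion_nonempty (A : set (measurableTypeR R)) : measurable A ->
  A `<=` J -> mu A = (\int[leb]_(x in A) (free_density mu x)%:E)%E.
Proof.
move=> mA AJ; rewrite -{1}(setIidl AJ) density_measureE// /density_measure /dens.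
rewrite -integral_mkcondr (setIidl AJ); apply: eq_integral => x.
rewrite inE => /AJ; rewrite /J /= in_itv /= => xab.
by have -> := clamp_id xab.
Qed.

Lemma restriction_dominated_nonempty (A : set (measurableTypeR R)) :
  measurable A -> leb A = 0%E -> mu (A `&` J) = 0%E.
Proof.
move=> mA A0; rewrite density_measureE//.
by apply: null_set_integral => //; apply: measurable_funTS; exact: measurable_dens.
Qed.

End Nonempty.

Let empty_itv : b < a -> [set` `[a, b]] = set0 :> set R.
Proof. by move=> ba; rewrite set_itv_ge// bnd_simp -ltNge. Qed.

Lemma stieltjes_inversion : has_free_density_on mu [set` `[a, b]].
Proof.
split=> [x|A mA Aab].
  by rewrite /= in_itv /= => xab; have [] := hlim xab.
have [ab|ba] := leP a b; first exact: stieltjes_inversion_nonempty.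
move: Aab; rewrite empty_itv// subset0 => ->.
by rewrite measure0 integral_set0.
Qed.

Lemma stieltjes_dominated :
  mrestr mu (measurable_itv `[a, b]) `<< leb.
Proof.
apply/null_content_dominatesP => A mA A0; rewrite /mrestr.
have [ab|ba] := leP a b; first exact: restriction_dominated_nonempty.
by rewrite empty_itv// setI0 measure0.
Qed.

End StieltjesInversion.

(** * Uniform estimates in the bulk *)

Section Bulk.
Context {R : realType}.
Variables (s e : R).
Hypotheses (s1 : 1 < s) (e0 : 0 < e).

Let s0 : 0 < s. Proof. exact: lt_trans s1. Qed.

(** The interval of the theorem for [lambda = s ^+ 2], with [2 * e] for the
    distance to the edges [1 + s^2 - 2 s] and [1 + s^2 + 2 s]. *)
Definition bulk (x : R) := `|x - 1 - s ^+ 2| <= 2 * s - 2 * e.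

(** A lower bound for the sine of the argument of [G] above the bulk. *)
Definition slope : R := Num.sqrt (e / (2 * s)).

Let k0 : 0 < slope. Proof. by rewrite sqrtr_gt0 divr_gt0// mulr_gt0. Qed.

Let slope_sqr : slope ^+ 2 = e / (2 * s).
Proof. by rewrite sqr_sqrtr// divr_ge0 ?mulr_ge0 ?(ltW s0) ?(ltW e0). Qed.

Definition inv_const : R := 4 / slope ^+ 2.

Lemma slopeP (G : R[i]) : 0 < Im G ->
  e / (2 * s) * modc G ^+ 2 <= Im G ^+ 2 -> slope * modc G <= Im G.
Proof.
move=> G0 h; rewrite -(@ler_pXn2r _ 2) ?nnegrE ?(ltW G0) ?mulr_ge0 ?(ltW k0) ?modc_ge0//.
by rewrite exprMn slope_sqr.
Qed.

Lemma inv_close (G1 G2 : R[i]) : slope / 2 <= Im G1 -> slope / 2 <= Im G2 ->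
  modc (- (1 + G1)^-1 - - (1 + G2)^-1) <= inv_const * modc (G1 - G2).
Proof.
have kp : 0 < slope / 2 by rewrite divr_gt0.
have aux (G : R[i]) : slope / 2 <= Im G -> slope / 2 <= modc (1 + G).
  move=> h; rewrite (le_trans h)// (le_trans _ (modc_Im _))//.
  by rewrite (le_trans _ (ler_norm _))// ImD /= add0r.
move=> /aux h1 /aux h2.
have n1 : 1 + G1 != 0 by rewrite -modc_gt0 (lt_le_trans kp).
have n2 : 1 + G2 != 0 by rewrite -modc_gt0 (lt_le_trans kp).
have -> : - (1 + G1)^-1 - - (1 + G2)^-1 = (G1 - G2) / ((1 + G1) * (1 + G2)).
  by field; rewrite n1 n2.
rewrite Normc.normcM Normc.normcV mulrC ler_wpM2r ?modc_ge0//.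
rewrite Normc.normcM /inv_const.
have -> : 4 / slope ^+ 2 = (slope / 2 * (slope / 2))^-1.
  by field; rewrite gt_eqF.
rewrite lef_pV2 ?posrE ?mulr_gt0//; first by rewrite ler_pM// ltW.
- by rewrite (lt_le_trans kp).
- by rewrite (lt_le_trans kp).
Qed.

(** The value at [x] of [-1/m - 1] for the Marchenko-Pastur law: the root of
    [G + s^2 / G = x - 1 - s^2] in the upper half-plane, on the circle of
    radius [s]. *)
Definition mp_G (x : R) : R[i] :=
  ((x - 1 - s ^+ 2) / 2) +i* (Num.sqrt (4 * s ^+ 2 - (x - 1 - s ^+ 2) ^+ 2) / 2).

(** On the circle [|G| = s] the denominator [|1 + G|^2] of [Im (- (1 + G)^-1)] is
    [1 + s^2 + 2 Re G = x], the one of the Marchenko-Pastur density. *)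
Lemma mp_G_props x : bulk x ->
  [/\ 0 < Im (mp_G x), modc (mp_G x) = s,
      mp_G x + (s ^+ 2)%:C / mp_G x = (x - 1 - s ^+ 2)%:C &
      pi * mp_density (s ^+ 2) x = Im (- (1 + mp_G x)^-1)].
Proof.
rewrite /bulk; set w := x - 1 - s ^+ 2 => hx.
have w2 : w ^+ 2 < 4 * s ^+ 2.
  rewrite -(real_normK (num_real w)).
  have -> : 4 * s ^+ 2 = (2 * s) ^+ 2 by ring.
  rewrite ltr_pXn2r ?nnegrE ?mulr_ge0 ?(ltW s0)//; move: hx e0; lra.
set D := 4 * s ^+ 2 - w ^+ 2.
have D0 : 0 < D by rewrite subr_gt0.
have I0 : 0 < Im (mp_G x) by rewrite /= divr_gt0// sqrtr_gt0.
have m2 : modc (mp_G x) ^+ 2 = s ^+ 2.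
  rewrite modc_sqr /= -/w -/D !expr_div_n sqr_sqrtr ?(ltW D0)// /D.
  by field.
have ms : modc (mp_G x) = s.
  by apply/eqP; rewrite -(@eqrXn2 _ 2)// ?modc_ge0 ?(ltW s0)// m2.
split => //.
- apply/eqP; rewrite eq_complex ReD ImD Re_realdiv Im_realdiv ms divff; last first.
    by rewrite gt_eqF// exprn_gt0.
  rewrite !mul1r subrr eqxx andbT /= -/w; apply/eqP.
  by field.
- have xE : x = w + 1 + s ^+ 2 by rewrite /w; ring.
  have x0 : 0 < x.
    rewrite xE; move: hx; rewrite ler_norml => /andP[h _].
    have := sqr_ge0 (s - 1); move: e0; nra.
  rewrite /mp_density /mp_min /mp_max sqrtr_sqr (ger0_norm (ltW s0)).
  have -> : (1 - s) ^+ 2 <= x <= (1 + s) ^+ 2.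
    move: hx; rewrite ler_norml => /andP[h1 h2]; rewrite xE.
    apply/andP; split; move: e0 h1 h2; nra.
  have -> : 4 * x - (1 - s ^+ 2 + x) ^+ 2 = D by rewrite xE /D; ring.
  have -> : (1 + mp_G x)^-1 = 1%:C / (1 + mp_G x) by rewrite mul1r.
  rewrite ImN Im_realdiv opprK.
  have -> : modc (1 + mp_G x) ^+ 2 = x.
    rewrite modc_sqr ReD ImD /= -/w -/D add0r expr_div_n sqr_sqrtr ?(ltW D0)//.
    by rewrite {1}xE /D; field.
  rewrite ImD /= add0r -/w -/D.
  move: (pi_gt0 R) (Num.sqrt D) => pi0 r; move: (pi : R) pi0 => c c0.
  by field; rewrite !gt_eqF.
Qed.

Lemma mp_G_slope x : bulk x -> slope / 2 <= Im (mp_G x).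
Proof.
move=> bx; have [I0 ms eG _] := mp_G_props bx.
have : slope * modc (mp_G x) <= Im (mp_G x).
  apply: slopeP => //; apply: (@bulk_slope _ s e x%:C) => //.
  by rewrite eG !rmorphB rmorph1 subrr Normc.normc0 ltW.
rewrite ms; apply: le_trans; rewrite ler_wpM2l ?(ltW k0)//; move: s1; lra.
Qed.

Section Law.
Variables (n : nat) (p : 'I_n -> R) (q : R) (mu : real_law R).
Hypothesis p01 : forall i, 0 <= p i <= 1.
Hypothesis hmu : is_free_sum [seq bernoulli_law (p i) | i : 'I_n] mu.
Hypothesis sp : sparse p q.
Let d := sparse_error p q (s ^+ 2).
Hypothesis de : d <= e.
Hypothesis dk : d <= slope / 2.

Local Notation h x y := (Im (stieltjes mu (x +i* y))).
Let G (z : R[i]) : R[i] := - (stieltjes mu z)^-1 - 1.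

Let stieltjesG z : stieltjes mu z = - (1 + G z)^-1.
Proof. by rewrite /G addrC subrK invrN invrK opprK. Qed.

Let bulk_point x y : bulk x -> 0 < y ->
  exists v, [/\ subordination_system p (x +i* y) (G (x +i* y)) v,
    slope * modc (G (x +i* y)) <= Im (G (x +i* y)) &
    slope / 2 <= Im (G (x +i* y))].
Proof.
move=> bx y0; have [v sys] := @bernoulli_sum_system _ _ _ _ (x +i* y) p01 hmu y0.
exists v; have Gp := system_Im_gt0 sp sys.
have h : slope * modc (G (x +i* y)) <= Im (G (x +i* y)).
  apply: slopeP => //; apply: (@bulk_slope _ s e (x +i* y)) => //.
  exact: le_trans (system_approx (s ^+ 2) sp sys) de.
split=> //; apply: le_trans h.
have h45 := modc_G_ge sp sys; rewrite ler_wpM2l ?(ltW k0)//; lra.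
Qed.

Definition lip_const : R := inv_const * (2 / slope).

Lemma inv_const_ge0 : 0 <= inv_const.
Proof. by rewrite /inv_const divr_ge0// sqr_ge0. Qed.

Lemma lip_const_ge0 : 0 <= lip_const.
Proof. by rewrite mulr_ge0 ?inv_const_ge0// divr_ge0 ?sqrtr_ge0. Qed.

Let modc_le_sum (a b : R) : modc (a +i* b) <= `|a| + `|b|.
Proof.
have -> : a +i* b = a%:C + 'i%C * b%:C by rewrite [LHS]complexE.
rewrite (le_trans (modcD _ _))// Normc.normcM !modcR.
by rewrite /= expr0n /= expr1n add0r sqrtr1 mul1r.
Qed.

(** [G] is Lipschitz in z, and [m = - (1 + G)^-1] is Lipschitz in [G] because
    [Im G] is bounded below. *)
Lemma law_lipschitz x x' y y' : bulk x -> bulk x' -> 0 < y -> 0 < y' ->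
  `|h x y - h x' y'| <= lip_const * (`|x - x'| + `|y - y'|).
Proof.
move=> bx bx' y0 y'0.
have [v [sys sl G1]] := bulk_point bx y0.
have [v' [sys' _ G2]] := bulk_point bx' y'0.
have hl := system_lipschitz sp sys sys' k0 (sqr_ge0 s) sl dk.
rewrite -ImN -ImD (le_trans (modc_Im _))// !stieltjesG (le_trans (inv_close G1 G2))//.
rewrite /lip_const -mulrA ler_wpM2l ?inv_const_ge0// (le_trans hl)// ler_wpM2l//.
  by rewrite divr_ge0 ?sqrtr_ge0.
exact: modc_le_sum.
Qed.

(** [G (x + iy)] and [mp_G x] satisfy the same equation up to [iy] and the
    error [d], and the equation is stable. *)
Lemma law_close x y : bulk x -> 0 < y ->
  `|h x y - pi * mp_density (s ^+ 2) x| <= inv_const / slope * (y + d).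
Proof.
move=> bx y0.
have [v [sys sl G1]] := bulk_point bx y0.
have [I0 ms eG ->] := mp_G_props bx.
have G2 := mp_G_slope bx.
rewrite -ImN -ImD (le_trans (modc_Im _))// !stieltjesG (le_trans (inv_close G1 G2))//.
rewrite -mulrA ler_wpM2l ?inv_const_ge0// mulrC ler_pdivlMr//.
have Gp := system_Im_gt0 sp sys.
have Gn : G (x +i* y) != 0 by exact: Im_neq0.
have Mn : mp_G x != 0 by exact: Im_neq0.
have st := joukowski_stable (sqr_ge0 s) Gp I0 sl.
have apx := system_approx (s ^+ 2) sp sys.
apply: (@le_trans _ _ (modc ((G (x +i* y) - mp_G x) *
    (1 - (s ^+ 2)%:C / (G (x +i* y) * mp_G x))))).
  by rewrite Normc.normcM ler_wpM2l ?modc_ge0.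
have -> : (G (x +i* y) - mp_G x) * (1 - (s ^+ 2)%:C / (G (x +i* y) * mp_G x)) =
   'i%C * y%:C - ((x +i* y) - 1 - (s ^+ 2)%:C -
     (G (x +i* y) + (s ^+ 2)%:C / G (x +i* y))).
  have -> : 'i%C * y%:C = (x +i* y) - x%:C
    by rewrite [x +i* y](_ : _ = x%:C + 'i%C * y%:C); [ring|exact: complexE].
  have := eG; rewrite !rmorphB rmorph1 => eG'.
  have -> : x%:C = (mp_G x + (s ^+ 2)%:C / mp_G x) + 1 + (s ^+ 2)%:C.
    by rewrite eG'; ring.
  by field; rewrite Gn Mn.
rewrite (le_trans (modcB _ _))// lerD//.
by rewrite Normc.normcM modcR /= expr0n /= expr1n add0r sqrtr1 mul1r gtr0_norm.
Qed.

Lemma density_close x : bulk x ->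
  `|free_density mu x - mp_density (s ^+ 2) x| <= pi^-1 * (inv_const / slope) * d.
Proof.
move=> bx.
have hy y y' : 0 < y -> 0 < y' -> `|h x y - h x y'| <= lip_const * `|y - y'|.
  by move=> y0 y'0; have := law_lipschitz bx bx y0 y'0; rewrite subrr normr0 add0r.
have [_ hlim] := lipschitz_right_limit lip_const_ge0 hy.
rewrite /free_density; set l := lim _ in hlim *.
have -> : pi^-1 * l - mp_density (s ^+ 2) x = pi^-1 * (l - pi * mp_density (s ^+ 2) x).
  by rewrite mulrBr mulrA mulVf ?mul1r// gt_eqF// pi_gt0.
rewrite normrM ger0_norm ?invr_ge0 ?pi_ge0// -mulrA ler_wpM2l ?invr_ge0 ?pi_ge0//.
set C := inv_const / slope.
have C0 : 0 <= C by rewrite divr_ge0 ?inv_const_ge0 ?sqrtr_ge0.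
apply/ler_addgt0Pr => t t0.
have LC : 0 < lip_const + C + 1 by rewrite ltr_wpDl// addr_ge0 ?lip_const_ge0.
pose y := t / (lip_const + C + 1).
have y0 : 0 < y by rewrite divr_gt0.
have ty : t = (lip_const + C + 1) * y by rewrite /y; field; rewrite gt_eqF.
have h1 := law_close bx y0; have h2 := hlim _ y0.
rewrite -/C in h1; rewrite distrC in h2.
move: (h x y) (pi * mp_density _ x) h1 h2 => A B h1 h2.
have := ler_normD (l - A) (A - B); rewrite addrA subrK ty.
move: h1 h2; lra.
Qed.

End Law.
End Bulk.

(** * Asymptotics *)

Section Asymptotics.
Context {R : realType}.
Variables (lambda : R) (p : forall n : nat, 'I_n -> R).
Hypothesis hp : forall (n : nat) (i : 'I_n), 0 <= p i <= 1.
Hypothesis hlambda : 1 < lambda.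
Hypothesis hsum : (\sum_(i < n) p i) @[n --> \oo] --> lambda.
Hypothesis hmax : (\big[Num.max/0]_(i < n) p i) @[n --> \oo] --> (0 : R).

Let P n : R := \big[Num.max/0]_(i < n) p i.
(** The least [q] with [p i <= q ^+ 2] for all [i]. *)
Definition sparsity n : R := Num.sqrt (\big[Num.max/0]_(i < n) p i).

Let P_ge0 n : 0 <= P n.
Proof.
rewrite /P; elim/big_ind: _ => // [x y x0 _|i _]; first by rewrite le_max x0.
by case/andP: (hp i).
Qed.

Let sparsity_sqr n : sparsity n ^+ 2 = P n.
Proof. by rewrite sqr_sqrtr//; exact: P_ge0. Qed.

Lemma near_sparse : \forall n \near \oo, sparse (@p n) (sparsity n).
Proof.
have h1 : \forall n \near \oo, P n <= 30^-1 ^+ 2.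
  by move/cvgr_le : hmax; apply; rewrite exprn_gt0// invr_gt0.
have h2 : \forall n \near \oo, 1 <= \sum_(i < n) p i.
  by move/cvgr_ge : hsum; apply.
apply: filterS2 h1 h2 => n h1 h2; split => //.
- rewrite sqrtr_ge0 -(@ler_pXn2r _ 2) ?nnegrE ?sqrtr_ge0 ?invr_ge0//.
  by rewrite sparsity_sqr.
- move=> i; have /andP[-> _] := hp i; rewrite sparsity_sqr /P.
  exact: le_bigmax.
Qed.

Lemma cvg_sparse_error :
  sparse_error (@p n) (sparsity n) lambda @[n --> \oo] --> (0 : R).
Proof.
have -> : (0 : R) = 3 * `|lambda - lambda| + 300 * 0 * lambda.
  by rewrite subrr normr0 !mulr0 mul0r addr0.
rewrite /sparse_error; apply: cvgD.
  apply: cvgM; first exact: cvg_cst.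
  by apply: cvg_norm; apply: cvgB => //; exact: cvg_cst.
apply: cvgM => //; apply: cvgM; first exact: cvg_cst.
by under eq_fun do rewrite sparsity_sqr.
Qed.

End Asymptotics.

Local Close Scope complex_scope.

Theorem theorem4p2 (R : realType) (lambda eps : R)
    (p : forall n : nat, 'I_n -> R) (mu : nat -> real_law R)
    (hp : forall (n : nat) (i : 'I_n), 0 <= p n i <= 1)
    (hmu : forall n : nat, (0 < n)%N ->
       is_free_sum [seq bernoulli_law (p n i) | i : 'I_n] (mu n))
    (hlambda : 1 < lambda)
    (hsum : (\sum_(i < n) p n i) @[n --> \oo] --> lambda)
    (hmax : (\big[Num.max/0]_(i < n) p n i) @[n --> \oo] --> (0 : R))
    (heps : 0 < eps) :
  let I_eps := [set` `[mp_min lambda + eps, mp_max lambda - eps]] in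
  (\forall n \near \oo,
     mrestr (mu n) (measurable_itv `[mp_min lambda + eps, mp_max lambda - eps])
       `<< @lebesgue_measure R /\
     has_free_density_on (mu n) I_eps) /\
  {uniform I_eps, (fun n : nat => free_density (mu n)) @ \oo
     --> mp_density lambda}.
Proof.
move=> I_eps.
set s := Num.sqrt lambda.
have ls : lambda = s ^+ 2 by rewrite sqr_sqrtr// ltW// (lt_trans _ hlambda).
have s1 : 1 < s.
  by rewrite -(@ltr_pXn2r _ 2) ?nnegrE ?sqrtr_ge0// expr1n -ls.
(* Half of the margin [eps] absorbs the error in the equation for [G]. *)
set e := eps / 2.
have e0 : 0 < e by rewrite divr_gt0.
have Ibulk x : mp_min lambda + eps <= x <= mp_max lambda - eps -> bulk s e x.
  rewrite /mp_min /mp_max -/s => /andP[h1 h2].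
  by rewrite /bulk ler_norml /e; apply/andP; split; lra.
pose d n := sparse_error (p n) (sparsity p n) lambda.
have d0 : d n @[n --> \oo] --> (0 : R) by exact: cvg_sparse_error.
have sl0 : 0 < slope s e by rewrite sqrtr_gt0 divr_gt0// mulr_gt0// (lt_trans _ s1).
have good : \forall n \near \oo, [/\ (0 < n)%N, sparse (p n) (sparsity p n),
    d n <= e & d n <= slope s e / 2].
  near=> n; split.
  - by near: n; exact: nbhs_infty_gt.
  - by near: n; exact: (near_sparse hp hlambda hsum hmax).
  - by near: n; move/cvgr_le : d0; apply.
  - by near: n; move/cvgr_le : d0; apply; rewrite divr_gt0.
split.
  apply: filterS good => n [n0 sp de dk].
  rewrite /d ls in de dk.
  have lip x x' y y' : mp_min lambda + eps <= x <= mp_max lambda - eps ->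
      mp_min lambda + eps <= x' <= mp_max lambda - eps -> 0 < y -> 0 < y' ->
      `|complex.Im (stieltjes (mu n) (Complex x y)) -
        complex.Im (stieltjes (mu n) (Complex x' y'))|
      <= lip_const s e * (`|x - x'| + `|y - y'|).
    move=> xI x'I y0 y'0.
    exact: (law_lipschitz s1 e0 (hp n) (hmu n n0) sp de dk (Ibulk _ xI) (Ibulk _ x'I)).
  split; first exact: (stieltjes_dominated (lip_const_ge0 s e) lip).
  exact: (stieltjes_inversion (lip_const_ge0 s e) lip).
move=> U /uniform_nbhs[E [entE subU]].
have [r r0 rE] : exists2 r : R, 0 < r & forall a b : R, `|a - b| < r -> E (a, b).
  move: entE; rewrite -entourage_ballE => -[r /= r0 rE]; exists r => // a b ab.
  exact: rE.
pose C := pi^-1 * (inv_const s e / slope s e).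
have C0 : 0 <= C.
  by rewrite mulr_ge0 ?invr_ge0 ?pi_ge0// divr_ge0 ?inv_const_ge0// ltW.
have small : \forall n \near \oo, d n < r / (C + 1).
  by move/cvgr_lt : d0; apply; rewrite divr_gt0// ltr_wpDl.
apply: filterS2 good small => n [n0 sp de dk] dr.
apply: subU => x; rewrite /I_eps /= in_itv /= => xI; apply: rE.
rewrite /d ls in de dk; rewrite distrC ls.
apply: le_lt_trans (density_close s1 e0 (hp n) (hmu n n0) sp de dk (Ibulk _ xI)) _.
move: dr; rewrite /d ls ltr_pdivlMr ?ltr_wpDl// -/C; apply: le_lt_trans.
rewrite [leRHS]mulrC ler_wpM2r ?lerDl//; exact: sparse_error_ge0.
Unshelve. all: by end_near. Qed.
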